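(* (Homological Shapiro lemma for partial actions) Let $\mathbb{K}$ be a field and let $W$ be a $\mathbb{K}_{par}G$-$\mathbb{K}H$-bimodule for some groups $G$ and $H$ such that $W$ is flat as a right $\mathbb{K}H$-module, $W$ is flat as a left $\mathbb{K}_{par}G$-module, and $B\otimes_{\mathbb{K}_{par}G}W$ is isomorphic to the trivial right $\mathbb{K}H$-module $\mathbb{K}$. Then, for any left $\mathbb{K}H$-module $U$, considering $W\otimes_{\mathbb{K}H}U$ as a left $\mathbb{K}_{par}G$-module, we have $$H_i^{par}(G,W\otimes_{\mathbb{K}H}U)\simeq H_i(H,U),\qquad i\ge0.$$
   Context: $\mathbb{K}_{par}G$ is the unital associative $\mathbb{K}$-algebra generated by symbols $[g]$, $g\in G$, subject to $[g][h][h^{-1}]=[gh][h^{-1}]$, $[g^{-1}][g][h]=[g^{-1}][gh]$ and $[1]=1$ for all $g,h\in G$. The elements $e_g=[g][g^{-1}]$ are pairwise commuting idempotents, and $B$ denotes the commutative subalgebra of $\mathbb{K}_{par}G$ generated by $\{e_g\mid g\in G\}$, viewed as a right $\mathbb{K}_{par}G$-module via $b^{[g]}=[g^{-1}]b[g]$. For a left $\mathbb{K}_{par}G$-module $V$, $H^{par}_n(G,V)=\mathrm{Tor}_n^{\mathbb{K}_{par}G}(B,V)$. $H_i(H,U)=\mathrm{Tor}_i^{\mathbb{K}H}(\mathbb{K},U)$ is ordinary group homology. Isomorphisms of homology groups are of $\mathbb{K}$-vector spaces. *)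

(* Defs.v *)
From HB Require Import structures.
From mathcomp Require Import all_boot all_order all_algebra.
From mathcomp Require Import boolp classical_sets.
From mathcomp Require Import finmap.
From mathcomp Require Import monalg.

Set Implicit Arguments.
Unset Strict Implicit.
Unset Printing Implicit Defensive.

Import GRing.Theory.
Local Open Scope ring_scope.
Local Open Scope quotient_scope.

HB.lock Definition malg_lift (R : nzRingType) (X : choiceType) (V : lmodType R)
  (h : X -> V) (g : {malg R[X]}) : V := \sum_(x <- msupp g) g@_x *: h x.

Section MalgLift.
Variables (R : nzRingType) (X : choiceType) (V : lmodType R) (h : X -> V).
Local Notation malg_lift := (malg_lift h).

Lemma malg_liftE g : malg_lift g = \sum_(x <- msupp g) g@_x *: h x.
Proof. by rewrite unlock. Qed.

Lemma malg_liftEw (d : {fset X}) g : (msupp g `<=` d)%fset ->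
  malg_lift g = \sum_(x <- d) g@_x *: h x.
Proof.
move=> le; rewrite malg_liftE [LHS](big_fset_incl _ le) => //= x xd /mcoeff_outdom ->.
by rewrite scale0r.
Qed.

Lemma malg_lift_is_linear : linear malg_lift.
Proof.
move=> a g1 g2; pose d := (msupp g1 `|` msupp g2)%fset.
rewrite (@malg_liftEw d g1) ?fsubsetUl // (@malg_liftEw d g2) ?fsubsetUr //.
rewrite (@malg_liftEw d) => [|]; last first.
  by apply: fsubset_trans (msuppD_le _ _) _; apply/fsetSU/msuppZ_le.
rewrite scaler_sumr -big_split /=; apply: eq_bigr => x _.
by rewrite mcoeffD mcoeffZ scalerDl scalerA.
Qed.

HB.instance Definition _ :=
  GRing.isLinear.Build R {malg R[X]} V *:%R malg_lift malg_lift_is_linear.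

Lemma malg_liftU c x : malg_lift << c *g x >> = c *: h x.
Proof. by rewrite (malg_liftEw msuppU_le) big_seq_fset1 mcoeffUU. Qed.

Lemma malg_lift1 x : malg_lift << x >> = h x.
Proof. by rewrite malg_liftU scale1r. Qed.

End MalgLift.

Lemma malgU_scale (R : nzRingType) (X : choiceType) (c : R) (x : X) :
  << c *g x >> = c *: << x >>.
Proof. by apply/malgP => y; rewrite mcoeffZ !mcoeffU mulrnAr mulr1. Qed.

Lemma malg_lin_ext (R : nzRingType) (X : choiceType) (V : lmodType R)
    (f g : {linear {malg R[X]} -> V}) :
  (forall x, f << x >> = g << x >>) -> f =1 g.
Proof.
move=> fg a; rewrite (monalgE a) !raddf_sum; apply: eq_bigr => x _ /=.
by rewrite malgU_scale !linearZ /= fg.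
Qed.

Definition monoid_algebra (K : comNzRingType) (M : monoidType) : Type :=
  {malg K[M]}.

HB.lock Definition monalg_mul (K : comNzRingType) (M : monoidType)
    (x y : {malg K[M]}) : {malg K[M]} :=
  \sum_(i <- msupp x) \sum_(j <- msupp y) << x@_i * y@_j *g (i * j)%g >>.

Section MonoidAlgebra.
Variables (K : comNzRingType) (M : monoidType).
Local Notation A := (monoid_algebra K M).

HB.instance Definition _ := GRing.Lmodule.copy A {malg K[M]}.

Definition monalg_one : A := << 1%g >>.

Local Notation monalg_mul := (@monalg_mul K M).

Let lmul (i : M) : {malg K[M]} -> {malg K[M]} :=
  malg_lift (fun j => << (i * j)%g >>).

Let mulE (x y : A) : monalg_mul x y = malg_lift (fun i => lmul i y) x.
Proof.
rewrite unlock malg_liftE; apply: eq_bigr => i _; rewrite /lmul malg_liftE scaler_sumr.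
by apply: eq_bigr => j _; rewrite scalerA malgU_scale.
Qed.

Let mulDl : left_distributive monalg_mul +%R.
Proof. by move=> x y z; rewrite !mulE raddfD. Qed.

Let mulZl c x y : monalg_mul (c *: x) y = c *: monalg_mul x y.
Proof. by rewrite !mulE linearZ. Qed.

Let mulDr : right_distributive monalg_mul +%R.
Proof.
move=> x y z; rewrite !mulE !malg_liftE -big_split /=; apply: eq_bigr => i _.
by rewrite -scalerDr /lmul raddfD.
Qed.

Let mulZr c x y : monalg_mul x (c *: y) = c *: monalg_mul x y.
Proof.
rewrite !mulE !malg_liftE scaler_sumr; apply: eq_bigr => i _.
by rewrite /lmul linearZ /= !scalerA mulrC.
Qed.

Let mulUU i j : monalg_mul << i >> << j >> = << (i * j)%g >>.
Proof. by rewrite mulE malg_lift1 /lmul malg_lift1. Qed.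

Let ind (P : A -> Prop) : P 0 -> (forall x y, P x -> P y -> P (x + y)) ->
  (forall c x, P x -> P (c *: x)) -> (forall i, P << i >>) -> forall x, P x.
Proof.
move=> P0 PD PZ PU x; rewrite (monalgE x); apply: big_ind => // i _.
by rewrite malgU_scale; apply: PZ.
Qed.

Let mul0l x : monalg_mul 0 x = 0.
Proof. by rewrite mulE raddf0. Qed.

Let mul0r x : monalg_mul x 0 = 0.
Proof. by have := mulZr 0 x 0; rewrite !scale0r. Qed.

Let mulA : associative monalg_mul.
Proof.
move=> x y z; move: x; apply: ind => [|x1 x2 e1 e2|c x e|i].
- by rewrite !mul0l.
- by rewrite !mulDl e1 e2.
- by rewrite !mulZl e.
move: y; apply: ind => [|y1 y2 e1 e2|c y e|j].
- by rewrite !(mul0l, mul0r).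
- by rewrite !(mulDl, mulDr) e1 e2.
- by rewrite !(mulZl, mulZr) e.
move: z; apply: ind => [|z1 z2 e1 e2|c z e|k].
- by rewrite !mul0r.
- by rewrite !mulDr e1 e2.
- by rewrite !mulZr e.
by rewrite !mulUU mulgA.
Qed.

Let mul1l : left_id monalg_one monalg_mul.
Proof.
apply: ind => [|x1 x2 e1 e2|c x e|i].
- by rewrite mul0r.
- by rewrite mulDr e1 e2.
- by rewrite mulZr e.
by rewrite mulUU mul1g.
Qed.

Let mul1r : right_id monalg_one monalg_mul.
Proof.
apply: ind => [|x1 x2 e1 e2|c x e|i].
- by rewrite mul0l.
- by rewrite mulDl e1 e2.
- by rewrite mulZl e.
by rewrite mulUU mulg1.
Qed.

Let one_neq0 : monalg_one != 0.
Proof.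
apply/eqP => /(congr1 (mcoeff 1%g)) /eqP.
by rewrite mcoeffUU mcoeff0 oner_eq0.
Qed.

HB.instance Definition _ := GRing.Zmodule_isNzRing.Build A
  mulA mul1l mul1r mulDl mulDr one_neq0.
HB.instance Definition _ := GRing.Lmodule_isLalgebra.Build K A
  (fun c x y => esym (mulZl c x y)).
HB.instance Definition _ := GRing.Lalgebra_isAlgebra.Build K A
  (fun c x y => esym (mulZr c x y)).

Definition monalgX (i : M) : A := << i >>.

Lemma monalgX1 : monalgX 1%g = 1. Proof. by []. Qed.

Lemma monalgXM i j : monalgX (i * j)%g = monalgX i * monalgX j.
Proof. by rewrite /monalgX -mulUU. Qed.

Lemma monalg_ind (P : A -> Prop) : P 0 ->
  (forall x y, P x -> P y -> P (x + y)) ->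
  (forall c x, P x -> P (c *: x)) -> (forall i, P (monalgX i)) ->
  forall x, P x.
Proof. exact: ind. Qed.

Definition monalg_lift (V : lmodType K) (h : M -> V) : A -> V := malg_lift h.

HB.instance Definition _ (V : lmodType K) (h : M -> V) :=
  GRing.isLinear.Build K A V *:%R (monalg_lift h) (malg_lift_is_linear h).

Lemma monalg_liftX (V : lmodType K) (h : M -> V) i :
  monalg_lift h (monalgX i) = h i.
Proof. exact: malg_lift1. Qed.

End MonoidAlgebra.

Definition group_algebra (K : fieldType) (H : groupType) : algType K :=
  monoid_algebra K H.

Definition free_monoid (X : Type) : Type := seq X.

Section FreeMonoid.
Variable X : choiceType.
HB.instance Definition _ := Choice.copy (free_monoid X) (seq X).
HB.instance Definition _ := isMonoid.Build (free_monoid X)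
  (@catA X) (@cat0s X) (@cats0 X).
End FreeMonoid.

Definition free_algebra (K : fieldType) (X : choiceType) : algType K :=
  monoid_algebra K (free_monoid X).

Definition free_gen (K : fieldType) (X : choiceType) (x : X) :
  free_algebra K X := @monalgX K (free_monoid X) [:: x].

Section QuotientModule.
Variables (R : pzRingType) (V : lmodType R) (S : set V).

Inductive in_span : V -> Prop :=
| span_gen x of S x : in_span x
| span0 : in_span 0
| spanD x y of in_span x & in_span y : in_span (x + y)
| spanZ a x of in_span x : in_span (a *: x).

Definition span_pred : {pred V} := fun x => `[< in_span x >].

Lemma span_predP x : reflect (in_span x) (x \in span_pred).
Proof. exact: asboolP. Qed.

Fact span_pred_zmod_closed : zmod_closed span_pred.
Proof.
split=> [|x y /span_predP xS /span_predP yS]; apply/span_predP.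
  exact: span0.
by rewrite -scaleN1r; apply: spanD => //; apply: spanZ.
Qed.

HB.instance Definition _ :=
  GRing.isZmodClosed.Build V span_pred span_pred_zmod_closed.

Definition qmod : Type := Quotient.quot span_pred.

Definition qmod_pi : V -> qmod := \pi_(Quotient.quot span_pred).

Lemma qmod_piP x y : (qmod_pi x = qmod_pi y) <-> in_span (x - y).
Proof.
rewrite /qmod_pi; split=> [xy|/span_predP].
  by apply/span_predP; rewrite Quotient.idealrBE; apply/eqP.
by rewrite Quotient.idealrBE => /eqP.
Qed.

Fact qmod_pi_surj (q : qmod) : {x | qmod_pi x = q}.
Proof. by exists (repr (q : Quotient.quot span_pred)); exact: reprK. Qed.

Definition qmod_repr (q : qmod) : V := sval (qmod_pi_surj q).

Lemma qmod_reprK : cancel qmod_repr qmod_pi.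
Proof. by move=> q; rewrite /qmod_repr; case: qmod_pi_surj. Qed.

Definition qmod_zero : qmod := qmod_pi 0.
Definition qmod_opp (p : qmod) : qmod := qmod_pi (- qmod_repr p).
Definition qmod_add (p q : qmod) : qmod := qmod_pi (qmod_repr p + qmod_repr q).

Let reprP x : in_span (qmod_repr (qmod_pi x) - x).
Proof. by apply/qmod_piP; rewrite qmod_reprK. Qed.

Let pi_opp x : qmod_opp (qmod_pi x) = qmod_pi (- x).
Proof.
by apply/qmod_piP; rewrite -opprD; have := spanZ (-1) (reprP x); rewrite scaleN1r.
Qed.

Let pi_add x y : qmod_add (qmod_pi x) (qmod_pi y) = qmod_pi (x + y).
Proof. by apply/qmod_piP; rewrite opprD addrACA; apply: spanD. Qed.

Fact qmod_addA : associative qmod_add.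
Proof.
move=> p q r; rewrite -(qmod_reprK p) -(qmod_reprK q) -(qmod_reprK r).
by rewrite !pi_add addrA.
Qed.

Fact qmod_addC : commutative qmod_add.
Proof. by move=> p q; rewrite /qmod_add addrC. Qed.

Fact qmod_add0 : left_id qmod_zero qmod_add.
Proof. by move=> p; rewrite -(qmod_reprK p) pi_add add0r. Qed.

Fact qmod_addN : left_inverse qmod_zero qmod_opp qmod_add.
Proof. by move=> p; rewrite -(qmod_reprK p) pi_opp pi_add addNr. Qed.

HB.instance Definition _ := gen_eqMixin qmod.
HB.instance Definition _ := gen_choiceMixin qmod.
HB.instance Definition _ :=
  GRing.isZmodule.Build qmod qmod_addA qmod_addC qmod_add0 qmod_addN.

Lemma qmod_pi_eq0 x : qmod_pi x = 0 <-> in_span x.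
Proof. by rewrite -[0]/(qmod_pi 0) qmod_piP subr0. Qed.

Definition qmod_scale (a : R) (q : qmod) : qmod := qmod_pi (a *: qmod_repr q).

Lemma qmod_scale_pi a x : qmod_scale a (qmod_pi x) = qmod_pi (a *: x).
Proof. by apply/qmod_piP; rewrite -scalerBr; apply: spanZ. Qed.

Let piD x y : qmod_pi (x + y) = qmod_pi x + qmod_pi y.
Proof. by rewrite -pi_add. Qed.

Fact qmod_scalerA a b q : qmod_scale a (qmod_scale b q) = qmod_scale (a * b) q.
Proof. by rewrite -(qmod_reprK q) !qmod_scale_pi scalerA. Qed.

Fact qmod_scale1r : left_id 1 qmod_scale.
Proof. by move=> q; rewrite -(qmod_reprK q) qmod_scale_pi scale1r. Qed.

Fact qmod_scalerDr : right_distributive qmod_scale +%R.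
Proof.
move=> a p q; rewrite -(qmod_reprK q) -(qmod_reprK p) -piD !qmod_scale_pi.
by rewrite scalerDr piD.
Qed.

Fact qmod_scalerDl q : {morph qmod_scale^~ q : a b / a + b}.
Proof.
by move=> a b; rewrite -(qmod_reprK q) !qmod_scale_pi scalerDl piD.
Qed.

HB.instance Definition _ := GRing.Zmodule_isLmodule.Build R qmod
  qmod_scalerA qmod_scale1r qmod_scalerDr qmod_scalerDl.

Fact qmod_pi_is_linear : linear qmod_pi.
Proof. by move=> a x y; rewrite piD -qmod_scale_pi. Qed.

HB.instance Definition _ :=
  GRing.isLinear.Build R V qmod *:%R qmod_pi qmod_pi_is_linear.

Section Lift.
Variables (W : lmodType R) (f : {linear V -> W}).
Hypothesis fS : forall x, S x -> f x = 0.

Definition qmod_lift of (forall x, S x -> f x = 0) : qmod -> W :=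
  fun q => f (qmod_repr q).

Lemma qmod_lift_pi x : qmod_lift fS (qmod_pi x) = f x.
Proof.
have fs z : in_span z -> f z = 0.
  elim=> {z} [z /fS //||y z _ fy _ fz|a z _ fz].
  - exact: linear0.
  - by rewrite linearD fy fz addr0.
  - by rewrite linearZ /= fz scaler0.
apply/eqP; rewrite -subr_eq0 -linearB /=; apply/eqP/fs.
exact: reprP.
Qed.

Fact qmod_lift_is_linear : linear (qmod_lift fS).
Proof.
move=> a p q; rewrite -(qmod_reprK p) -(qmod_reprK q) -linearP.
by rewrite !qmod_lift_pi linearP.
Qed.

HB.instance Definition _ :=
  GRing.isLinear.Build R qmod W *:%R (qmod_lift fS) qmod_lift_is_linear.

End Lift.
End QuotientModule.

Arguments qmod_pi {R V} S x.

(* A right R-module is a left module over the converse ring R^c.  Modules over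
   a K-algebra R are vector spaces over K through k |-> k%:A; the last family
   of relations makes the K-structure of the tensor product the expected one,
   k (m (x) n) = (k m) (x) n = m (x) (k n). *)

Section Tensor.
Variables (K : fieldType) (R : algType K).
Variables (M : lmodType R^c) (N : lmodType R).

Definition tensor_free : lmodType K := {malg K[(M * N)%type]}.

Variant tensor_rel : tensor_free -> Prop :=
| TensorDl m m' n :
    tensor_rel (<< (m + m', n) >> - (<< (m, n) >> + << (m', n) >>))
| TensorDr m n n' :
    tensor_rel (<< (m, n + n') >> - (<< (m, n) >> + << (m, n') >>))
| TensorBal m (r : R) n :
    tensor_rel (<< ((r : R^c) *: m, n) >> - << (m, r *: n) >>)
| TensorZ (k : K) m n :
    tensor_rel (<< (m, (k%:A : R) *: n) >> - k *: << (m, n) >>).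

Definition tensor : Type := qmod tensor_rel.

HB.instance Definition _ := GRing.Lmodule.on tensor.

Definition tens (m : M) (n : N) : tensor := qmod_pi tensor_rel << (m, n) >>.

Lemma tensDl m m' n : tens (m + m') n = tens m n + tens m' n.
Proof.
by rewrite /tens -raddfD; apply/qmod_piP; apply: span_gen; exact: TensorDl.
Qed.

Lemma tensDr m n n' : tens m (n + n') = tens m n + tens m n'.
Proof.
by rewrite /tens -raddfD; apply/qmod_piP; apply: span_gen; exact: TensorDr.
Qed.

Lemma tens_bal m (r : R) n : tens ((r : R^c) *: m) n = tens m (r *: n).
Proof. by apply/qmod_piP; apply: span_gen; exact: TensorBal. Qed.

Lemma tensZr (k : K) m n : tens m ((k%:A : R) *: n) = k *: tens m n.
Proof.
by rewrite /tens -linearZ; apply/qmod_piP; apply: span_gen; exact: TensorZ.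
Qed.

Lemma tensZl (k : K) m n : tens ((k%:A : R^c) *: m) n = k *: tens m n.
Proof. by rewrite -tensZr -tens_bal. Qed.

Lemma tensor_ind (P : tensor -> Prop) :
  P 0 -> (forall x y, P x -> P y -> P (x + y)) ->
  (forall m n, P (tens m n)) -> forall t, P t.
Proof.
move=> P0 PD Pt t; rewrite -(qmod_reprK t) (monalgE (qmod_repr t)) linear_sum.
apply: big_ind => // -[m n] _; rewrite malgU_scale linearZ /=.
by rewrite -[qmod_pi _ _]/(tens m n) -tensZl.
Qed.

Section Lift.
Variables (V : lmodType K) (b : M -> N -> V).

Definition balanced_bilinear : Prop :=
  [/\ forall m m' n, b (m + m') n = b m n + b m' n,
      forall m n n', b m (n + n') = b m n + b m n',
      forall m (r : R) n, b ((r : R^c) *: m) n = b m (r *: n)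
    & forall (k : K) m n, b m ((k%:A : R) *: n) = k *: b m n].

Hypothesis bb : balanced_bilinear.

Fact tensor_lift_subproof x :
  tensor_rel x ->
  (malg_lift (fun p : M * N => b p.1 p.2) : {linear tensor_free -> V}) x = 0.
Proof.
case: bb => bDl bDr bbal bZ.
by case=> [m m' n|m n n'|m r n|k m n]; apply/eqP; rewrite linearB subr_eq0;
  rewrite ?linearD ?linearZ /= !malg_lift1 /= ?bDl ?bDr ?bbal ?bZ.
Qed.

End Lift.

Definition tensor_lift (V : lmodType K) (b : M -> N -> V)
    (bb : balanced_bilinear b) : tensor -> V :=
  qmod_lift (tensor_lift_subproof bb).

Fact tensor_lift_is_linear (V : lmodType K) (b : M -> N -> V)
  (bb : balanced_bilinear b) : linear (tensor_lift bb).
Proof. exact: linearP. Qed.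

HB.instance Definition _ (V : lmodType K) (b : M -> N -> V)
    (bb : balanced_bilinear b) :=
  GRing.isLinear.Build K tensor V *:%R (tensor_lift bb)
    (tensor_lift_is_linear bb).

Lemma tensor_lift_tens (V : lmodType K) (b : M -> N -> V)
  (bb : balanced_bilinear b) m n : tensor_lift bb (tens m n) = b m n.
Proof. by rewrite /tensor_lift qmod_lift_pi /= malg_lift1. Qed.

End Tensor.

Arguments tens {K R M N}.

Section TensorMap.
Variables (K : fieldType) (R : algType K).
Variables (M M' : lmodType R^c) (N N' : lmodType R).
Variables (f : {linear M -> M'}) (g : {linear N -> N'}).

Fact tensor_map_subproof :
  balanced_bilinear (fun m n => tens (f m) (g n) : tensor M' N').
Proof.
split=> *; rewrite ?(linearD, linearZ) /=.
- exact: tensDl.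
- exact: tensDr.
- exact: tens_bal.
- exact: tensZr.
Qed.

Definition tensor_map : tensor M N -> tensor M' N' :=
  tensor_lift tensor_map_subproof.

Fact tensor_map_is_linear : linear tensor_map.
Proof. exact: linearP. Qed.

HB.instance Definition _ :=
  GRing.isLinear.Build K (tensor M N) (tensor M' N') *:%R tensor_map
    tensor_map_is_linear.

Lemma tensor_map_tens m n : tensor_map (tens m n) = tens (f m) (g n).
Proof. exact: tensor_lift_tens. Qed.

End TensorMap.

Definition exact_seq (U V W : zmodType) (f : U -> V) (g : V -> W) : Prop :=
  forall y, g y = 0 <-> exists x, f x = y.

Definition surjective (U V : Type) (f : U -> V) : Prop :=
  forall y, exists x, f x = y.

Section Flat.
Variables (K : fieldType) (R : algType K).

Definition flat_right (M : lmodType R^c) : Prop :=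
  forall (N1 N2 N3 : lmodType R) (f : {linear N1 -> N2}) (g : {linear N2 -> N3}),
  exact_seq f g ->
  exact_seq (tensor_map (idfun : {linear M -> M}) f)
        (tensor_map (idfun : {linear M -> M}) g).

Definition flat_left (N : lmodType R) : Prop :=
  forall (M1 M2 M3 : lmodType R^c)
         (f : {linear M1 -> M2}) (g : {linear M2 -> M3}),
  exact_seq f g ->
  exact_seq (tensor_map f (idfun : {linear N -> N}))
        (tensor_map g (idfun : {linear N -> N})).

End Flat.

Definition projective (R : pzRingType) (P : lmodType R) : Prop :=
  forall (M N : lmodType R) (f : {linear M -> N}) (g : {linear P -> N}),
  surjective f -> exists h : {linear P -> M}, forall x, f (h x) = g x.

Record projective_resolution (R : pzRingType) (V : lmodType R) :=
  ProjectiveResolution {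
    res_obj :> nat -> lmodType R;
    res_d : forall n, {linear res_obj n.+1 -> res_obj n};
    res_aug : {linear res_obj 0 -> V};
    res_projective : forall n, projective (res_obj n);
    res_aug_surj : surjective res_aug;
    res_exact0 : exact_seq (res_d 0) res_aug;
    res_exactS : forall n, exact_seq (res_d n.+1) (res_d n)
  }.

Definition isomorphic (R : pzRingType) (V W : lmodType R) : Prop :=
  exists f : {linear V -> W}, bijective f.

Section Homology.
Variables (R : pzRingType) (C : nat -> lmodType R).
Variable d : forall n, {linear C n.+1 -> C n}.

Definition cycle_pred (n : nat) : {pred C n} :=
  match n with
  | 0 => fun _ => true
  | m.+1 => fun x : C m.+1 => d m x == 0
  end.
Arguments cycle_pred n x : clear implicits.

Fact cycle_pred_submod_closed n : submod_closed (cycle_pred n).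
Proof.
case: n => [|n]; split=> //; rewrite ?unfold_in /= ?linear0 //.
move=> a x y; rewrite !unfold_in /= => /eqP dx /eqP dy.
by rewrite linearP /= dx dy scaler0 addr0.
Qed.

HB.instance Definition _ n :=
  GRing.isSubmodClosed.Build R (C n) (cycle_pred n)
    (cycle_pred_submod_closed n).

Record cycles (n : nat) : Type :=
  Cycle { cycle_val : C n; _ : cycle_val \in cycle_pred n }.

HB.instance Definition _ n := [isSub for @cycle_val n].
HB.instance Definition _ n := [Choice of cycles n by <:].
HB.instance Definition _ n := [SubChoice_isSubLmodule of cycles n by <:].

Definition boundary (n : nat) : set (cycles n) :=
  [set z | exists y, cycle_val z = d n y]%classic.

(* The quotient of the submodule ker d_n by the (span of the) image of d_(n+1); in
   degree 0 every element is a cycle. *)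
Definition homology (n : nat) : lmodType R := qmod (@boundary n).

End Homology.

(* Tor_n^R(M, N), computed as H_n(M (x)_R P) from a projective resolution P of
   the left module N; free_resolution below provides such a resolution for
   every N. *)
Definition Tor (K : fieldType) (R : algType K) (n : nat) (M : lmodType R^c)
    (N : lmodType R) (P : projective_resolution N) : lmodType K :=
  @homology K (fun i => tensor M (P i))
    (fun i => tensor_map (idfun : {linear M -> M}) (res_d P i)) n.

Section FreeResolution.
Variable R : nzRingType.

Lemma free_projective (X : choiceType) : projective {malg R[X]}.
Proof.
move=> M N f g fsurj.
have /choice [h fh] : forall x, exists y, f y = g << x >> by move=> x.
exists (malg_lift h) => x; rewrite -[f _]/((f \o malg_lift h) x).
by apply: malg_lin_ext x => x /=; rewrite malg_lift1.
Qed.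

Definition free_cover (V : lmodType R) : {malg R[V]} -> V := malg_lift id.
HB.instance Definition _ (V : lmodType R) := GRing.Linear.on (@free_cover V).

Lemma free_cover_surj V : surjective (@free_cover V).
Proof. by move=> v; exists << v >>; rewrite /free_cover malg_lift1. Qed.

Definition syzygy_pred (V : lmodType R) : {pred {malg R[V]}} :=
  fun x => free_cover x == 0.

Fact syzygy_submod_closed V : submod_closed (@syzygy_pred V).
Proof.
split=> [|a x y]; rewrite !unfold_in /= ?linear0 //.
by move=> /eqP dx /eqP dy; rewrite linearP /= dx dy scaler0 addr0.
Qed.

HB.instance Definition _ (V : lmodType R) :=
  GRing.isSubmodClosed.Build R {malg R[V]} (@syzygy_pred V)
    (@syzygy_submod_closed V).

Record syzygy (V : lmodType R) : Type :=
  Syzygy { syzygy_val : {malg R[V]}; _ : syzygy_val \in @syzygy_pred V }.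

HB.instance Definition _ (V : lmodType R) := [isSub for @syzygy_val V].
HB.instance Definition _ (V : lmodType R) := [Choice of syzygy V by <:].
HB.instance Definition _ (V : lmodType R) := [SubChoice_isSubLmodule of syzygy V by <:].

Variable V : lmodType R.

Definition iter_syzygy (n : nat) : lmodType R :=
  iter n (fun U : lmodType R => (syzygy U : lmodType R)) V.

Definition free_res_obj (n : nat) : lmodType R := {malg R[iter_syzygy n]}.

Definition free_res_d (n : nat) : {linear free_res_obj n.+1 -> free_res_obj n} :=
  (val : {linear syzygy (iter_syzygy n) -> {malg R[iter_syzygy n]}})
    \o @free_cover (syzygy (iter_syzygy n)).

Let exact_syz (U : lmodType R) : 
  exact_seq ((val : {linear syzygy U -> {malg R[U]}}) \o @free_cover (syzygy U))
     (@free_cover U).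
Proof.
move=> y; split=> [y0|[x <-]] /=; last by apply/eqP; case: (free_cover x).
have [x xE] := free_cover_surj (Syzygy (introT eqP y0)).
by exists x; rewrite /= xE.
Qed.

Lemma free_res_exactS n : exact_seq (free_res_d n.+1) (free_res_d n).
Proof.
move=> y; rewrite -(@exact_syz (syzygy (iter_syzygy n)) y) /=.
split=> [y0|y0]; first by apply: val_inj.
exact: (congr1 val y0).
Qed.

Definition free_resolution : projective_resolution V :=
  @ProjectiveResolution R V free_res_obj free_res_d (@free_cover V)
    (fun n => @free_projective (iter_syzygy n)) (@free_cover_surj V)
    (@exact_syz V) free_res_exactS.

End FreeResolution.

(* An A-S-bimodule over K-algebras A and S: commuting left and right actions
   inducing the same K-vector space structure. *)
HB.mixin Record Lmodule_isBimodule (K : fieldType) (A S : algType K) V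
    of GRing.Lmodule A V := {
  ract : V -> S -> V;
  ractDl : forall s, {morph ract^~ s : v w / v + w};
  ractDr : forall v, {morph ract v : s t / s + t};
  ractA : forall v s t, ract v (s * t) = ract (ract v s) t;
  ract1 : forall v, ract v 1 = v;
  ractZl : forall (a : A) v s, ract (a *: v) s = a *: ract v s;
  ract_central : forall (k : K) v, ract v k%:A = (k%:A : A) *: v
}.

#[short(type="bimodType")]
HB.structure Definition Bimodule (K : fieldType) (A S : algType K) :=
  { V of Lmodule_isBimodule K A S V & GRing.Lmodule A V }.

Definition right_of (K : fieldType) (A S : algType K) (W : bimodType A S) : Type :=
  W.

Section RightOf.
Variables (K : fieldType) (A S : algType K) (W : bimodType A S).

HB.instance Definition _ := GRing.Zmodule.on (right_of W).

Let scale (s : S^c) (w : right_of W) : right_of W := ract w (s : S).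

Fact right_scalerA s t w : scale s (scale t w) = scale (s * t) w.
Proof. by rewrite /scale -ractA. Qed.
Fact right_scale1r : left_id 1 scale.
Proof. exact: ract1. Qed.
Fact right_scalerDr : right_distributive scale +%R.
Proof. by move=> s v w; rewrite /scale ractDl. Qed.
Fact right_scalerDl w : {morph scale^~ w : s t / s + t}.
Proof. by move=> s t; rewrite /scale ractDr. Qed.

HB.instance Definition _ := GRing.Zmodule_isLmodule.Build S^c (right_of W)
  right_scalerA right_scale1r right_scalerDr right_scalerDl.

Lemma right_scaleE (s : S) (w : W) :
  (s : S^c) *: (w : right_of W) = ract w s.
Proof. by []. Qed.

Definition lact (a : A) : right_of W -> right_of W := fun w => a *: (w : W).

Fact lact_is_linear a : linear (lact a).
Proof.
move=> s v w.
rewrite -[LHS]/(a *: (ract (v : W) s + w : W)) scalerDr -ractZl.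
exact: erefl.
Qed.

HB.instance Definition _ a :=
  GRing.isLinear.Build S^c (right_of W) (right_of W) *:%R (lact a)
    (lact_is_linear a).

Definition ract_by (s : S) : W -> W := fun w => ract w s.

Fact ract_by_is_linear s : linear (ract_by s).
Proof. by move=> a v w; rewrite /ract_by ractDl ractZl. Qed.

HB.instance Definition _ s :=
  GRing.isLinear.Build A W W *:%R (ract_by s) (ract_by_is_linear s).

End RightOf.

(* W (x)_S U as a left A-module, for an A-S-bimodule W. *)
Definition bimod_tensor (K : fieldType) (A S : algType K) (W : bimodType A S)
  (U : lmodType S) : Type := tensor (right_of W) U.

Section BimodTensor.
Variables (K : fieldType) (A S : algType K) (W : bimodType A S).
Variable U : lmodType S.
Local Notation T := (tensor (right_of W) U).

(* a (w (x) u) = (a w) (x) u *)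
Definition bimod_tensor_scale (a : A) : T -> T :=
  tensor_map (lact a) (idfun : {linear U -> U}).

Let scaleU a (w : W) u :
  bimod_tensor_scale a (tens (w : right_of W) u)
  = tens (a *: w : right_of W) u.
Proof. exact: tensor_map_tens. Qed.

Let scale0 a : bimod_tensor_scale a 0 = 0.
Proof. exact: linear0. Qed.

Fact bimod_tensor_scalerDr : right_distributive bimod_tensor_scale +%R.
Proof.
by move=> a x y; rewrite /bimod_tensor_scale linearD.
Qed.

Fact bimod_tensor_scalerA a b t :
  bimod_tensor_scale a (bimod_tensor_scale b t) = bimod_tensor_scale (a * b) t.
Proof.
move: t; apply: tensor_ind => [|x y ex ey|w u].
- by rewrite !scale0.
- by rewrite !bimod_tensor_scalerDr ex ey.
by rewrite !scaleU scalerA.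
Qed.

Fact bimod_tensor_scale1r : left_id 1 bimod_tensor_scale.
Proof.
apply: tensor_ind => [|x y ex ey|w u].
- by rewrite !scale0.
- by rewrite !bimod_tensor_scalerDr ex ey.
by rewrite !scaleU scale1r.
Qed.

Fact bimod_tensor_scalerDl t : {morph bimod_tensor_scale^~ t : a b / a + b}.
Proof.
move=> a b; move: t; apply: tensor_ind => [|x y ex ey|w u].
- by rewrite !scale0 addr0.
- by rewrite !bimod_tensor_scalerDr ex ey addrACA.
by rewrite !scaleU scalerDl; exact: (@tensDl K S (right_of W) U).
Qed.

HB.instance Definition _ := GRing.Zmodule.copy (bimod_tensor W U) T.
HB.instance Definition _ := GRing.Zmodule_isLmodule.Build A (bimod_tensor W U)
  bimod_tensor_scalerA bimod_tensor_scale1r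
  bimod_tensor_scalerDr bimod_tensor_scalerDl.

Lemma bimod_tensor_scale_tens (a : A) (w : W) (u : U) :
  a *: (tens (w : right_of W) u : bimod_tensor W U) = tens (a *: w : right_of W) u.
Proof. exact: scaleU. Qed.

End BimodTensor.

(* M (x)_A W as a right S-module, for an A-S-bimodule W. *)
Definition tensor_bimod (K : fieldType) (A S : algType K) (M : lmodType A^c)
  (W : bimodType A S) : Type := tensor M W.

Section TensorBimod.
Variables (K : fieldType) (A S : algType K) (M : lmodType A^c).
Variable W : bimodType A S.
Local Notation T := (tensor M W).

(* (m (x) w) s = m (x) (w s) *)
Definition tensor_bimod_scale (s : S^c) : T -> T :=
  tensor_map (idfun : {linear M -> M}) (@ract_by K A S W s).

Let scaleU s m (w : W) : tensor_bimod_scale s (tens m w) = tens m (ract w s).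
Proof. exact: tensor_map_tens. Qed.

Let scale0 s : tensor_bimod_scale s 0 = 0.
Proof. exact: linear0. Qed.

Fact tensor_bimod_scalerDr : right_distributive tensor_bimod_scale +%R.
Proof.
by move=> s x y; rewrite /tensor_bimod_scale linearD.
Qed.

Fact tensor_bimod_scalerA s s' t :
  tensor_bimod_scale s (tensor_bimod_scale s' t)
  = tensor_bimod_scale (s * s') t.
Proof.
move: t; apply: tensor_ind => [|x y ex ey|m w].
- by rewrite !scale0.
- by rewrite !tensor_bimod_scalerDr ex ey.
by rewrite !scaleU -ractA.
Qed.

Fact tensor_bimod_scale1r : left_id 1 tensor_bimod_scale.
Proof.
apply: tensor_ind => [|x y ex ey|m w].
- by rewrite !scale0.
- by rewrite !tensor_bimod_scalerDr ex ey.
by rewrite !scaleU ract1.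
Qed.

Fact tensor_bimod_scalerDl t : {morph tensor_bimod_scale^~ t : a b / a + b}.
Proof.
move=> a b; move: t; apply: tensor_ind => [|x y ex ey|m w].
- by rewrite !scale0 addr0.
- by rewrite !tensor_bimod_scalerDr ex ey addrACA.
by rewrite !scaleU ractDr tensDr.
Qed.

HB.instance Definition _ := GRing.Zmodule.copy (tensor_bimod M W) T.
HB.instance Definition _ := GRing.Zmodule_isLmodule.Build S^c (tensor_bimod M W)
  tensor_bimod_scalerA tensor_bimod_scale1r
  tensor_bimod_scalerDr tensor_bimod_scalerDl.

Lemma tensor_bimod_scale_tens (s : S) (m : M) (w : W) :
  (s : S^c) *: (tens m w : tensor_bimod M W) = tens m (ract w s).
Proof. exact: scaleU. Qed.

End TensorBimod.

Definition ideal_gen (K : fieldType) (A : algType K) (X : set A) : set A :=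
  [set y | exists a r b, X r /\ y = a * r * b]%classic.

HB.lock Definition qalg_mul (K : fieldType) (A : algType K) (X : set A)
    (p q : qmod (ideal_gen X)) : qmod (ideal_gen X) :=
  qmod_pi (ideal_gen X) (qmod_repr p * qmod_repr q).

Section QuotientAlgebra.
Variables (K : fieldType) (A : algType K) (X : set A).
Local Notation ideal_gen := (ideal_gen X).
Local Notation qalg_mul := (@qalg_mul K A X).

Local Notation Q := (qmod ideal_gen).
Local Notation pi := (qmod_pi ideal_gen).

Definition qalg_one : Q := pi 1.

Let idealMl a x : in_span ideal_gen x -> in_span ideal_gen (a * x).
Proof.
elim=> [_ [b [r [c [Xr ->]]]]||y z _ ey _ ez|k y _ ey].
- by apply: span_gen; exists (a * b), r, c; rewrite !mulrA.
- by rewrite mulr0; apply: span0.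
- by rewrite mulrDr; apply: spanD.
by rewrite -scalerAr; apply: spanZ.
Qed.

Let idealMr a x : in_span ideal_gen x -> in_span ideal_gen (x * a).
Proof.
elim=> [_ [b [r [c [Xr ->]]]]||y z _ ey _ ez|k y _ ey].
- by apply: span_gen; exists b, r, (c * a); rewrite !mulrA.
- by rewrite mul0r; apply: span0.
- by rewrite mulrDl; apply: spanD.
by rewrite -scalerAl; apply: spanZ.
Qed.

Lemma qalg_mul_pi x y : qalg_mul (pi x) (pi y) = pi (x * y).
Proof.
rewrite unlock; apply/qmod_piP; set x' := qmod_repr _; set y' := qmod_repr _.
have -> : x' * y' - x * y = (x' - x) * y' + x * (y' - y).
  by rewrite mulrBl mulrBr addrA subrK.
by apply: spanD; [apply: idealMr | apply: idealMl]; apply/qmod_piP;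
  rewrite qmod_reprK.
Qed.

Let qmod_piK (P : Q -> Prop) : (forall x, P (pi x)) -> forall q, P q.
Proof. by move=> Ppi q; rewrite -(qmod_reprK q). Qed.

Let piZ k x : k *: pi x = pi (k *: x).
Proof. by rewrite linearZ. Qed.

Fact qalg_mulA : associative qalg_mul.
Proof.
move=> p q r; move: p q r; do 3!apply: qmod_piK => ?.
by rewrite !qalg_mul_pi mulrA.
Qed.

Fact qalg_mul1l : left_id qalg_one qalg_mul.
Proof. by apply: qmod_piK => x; rewrite qalg_mul_pi mul1r. Qed.

Fact qalg_mul1r : right_id qalg_one qalg_mul.
Proof. by apply: qmod_piK => x; rewrite qalg_mul_pi mulr1. Qed.

Fact qalg_mulDl : left_distributive qalg_mul +%R.
Proof.
move=> p q r; rewrite -(qmod_reprK p) -(qmod_reprK q) -(qmod_reprK r).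
by rewrite -linearD !qalg_mul_pi -linearD -mulrDl.
Qed.

Fact qalg_mulDr : right_distributive qalg_mul +%R.
Proof.
move=> p q r; rewrite -(qmod_reprK p) -(qmod_reprK q) -(qmod_reprK r).
by rewrite -linearD !qalg_mul_pi -linearD -mulrDr.
Qed.

Fact qalg_scaleAl k p q : k *: qalg_mul p q = qalg_mul (k *: p) q.
Proof.
rewrite -(qmod_reprK p) -(qmod_reprK q).
by rewrite piZ !qalg_mul_pi piZ scalerAl.
Qed.

Fact qalg_scaleAr k p q : k *: qalg_mul p q = qalg_mul p (k *: q).
Proof.
rewrite -(qmod_reprK p) -(qmod_reprK q).
by rewrite piZ !qalg_mul_pi piZ scalerAr.
Qed.

End QuotientAlgebra.

Section PartialGroupAlgebra.
Variables (K : fieldType) (G : groupType).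
Local Notation F := (free_algebra K G).
Local Notation "<[ g ]>" := (@free_gen K G g).

Variant par_rel : F -> Prop :=
| ParRelR g h :
    par_rel (<[g]> * <[h]> * <[h^-1%g]> - <[(g * h)%g]> * <[h^-1%g]>)
| ParRelL g h :
    par_rel (<[g^-1%g]> * <[g]> * <[h]> - <[g^-1%g]> * <[(g * h)%g]>)
| ParRel1 : par_rel (<[1%g]> - 1).

Definition par_algebra : Type := qmod (ideal_gen par_rel).

HB.instance Definition _ := GRing.Lmodule.on par_algebra.

(* The trivial representation [g] |-> 1, which shows 1 != 0. *)
Let triv : F -> K := monalg_lift (fun _ : free_monoid G => (1 : K^o)).

Let trivD x y : triv (x + y) = triv x + triv y.
Proof. exact: (linearD (monalg_lift (fun _ : free_monoid G => (1 : K^o)))). Qed.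
Let trivZ k x : triv (k *: x) = k * triv x.
Proof. exact: (linearZ_LR (monalg_lift (fun _ : free_monoid G => (1 : K^o)))). Qed.
Let triv0 : triv 0 = 0.
Proof. exact: (linear0 (monalg_lift (fun _ : free_monoid G => (1 : K^o)))). Qed.
Let trivX w : triv (monalgX K w) = 1.
Proof.
exact: (@monalg_liftX K (free_monoid G) K^o (fun _ : free_monoid G => 1) w).
Qed.

Let trivM x y : triv (x * y) = triv x * triv y.
Proof.
move: x; apply: monalg_ind => [|x1 x2 e1 e2|k x e|v].
- by rewrite mul0r triv0 mul0r.
- by rewrite mulrDl !trivD e1 e2 mulrDl.
- by rewrite -scalerAl !trivZ e mulrA.
move: y; apply: monalg_ind => [|x1 x2 e1 e2|k x e|w].
- by rewrite mulr0 triv0 mulr0.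
- by rewrite mulrDr !trivD e1 e2 mulrDr.
- by rewrite -scalerAr !trivZ e mulrCA.
by rewrite -monalgXM !trivX mulr1.
Qed.

Let trivB x y : triv (x - y) = triv x - triv y.
Proof. by rewrite trivD -scaleN1r trivZ mulN1r. Qed.

Let triv_rel r : par_rel r -> triv r = 0.
Proof.
have tg g : triv <[g]> = 1 by exact: trivX.
have t1 : triv 1 = 1 by rewrite -(monalgX1 K (free_monoid G)) trivX.
by case=> [g h|g h|]; rewrite trivB ?trivM ?tg ?t1 ?mulr1 subrr.
Qed.

Fact par_algebra_one_neq0 : qalg_one par_rel != 0.
Proof.
apply/eqP => /qmod_pi_eq0.
suff sp x : in_span (ideal_gen par_rel) x -> triv x = 0.
  move/sp; rewrite -(monalgX1 K (free_monoid G)) trivX => /eqP.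
  by rewrite oner_eq0.
elim=> [_ [b [r [c [/triv_rel r0 ->]]]]||y z _ ey _ ez|k y _ ey].
- by rewrite !trivM r0 mulr0 mul0r.
- exact: triv0.
- by rewrite trivD ey ez addr0.
by rewrite trivZ ey mulr0.
Qed.

HB.instance Definition _ := GRing.Zmodule_isNzRing.Build par_algebra
  (@qalg_mulA K F par_rel) (@qalg_mul1l K F par_rel) (@qalg_mul1r K F par_rel)
  (@qalg_mulDl K F par_rel) (@qalg_mulDr K F par_rel) par_algebra_one_neq0.
HB.instance Definition _ := GRing.Lmodule_isLalgebra.Build K par_algebra
  (@qalg_scaleAl K F par_rel).
HB.instance Definition _ := GRing.Lalgebra_isAlgebra.Build K par_algebra
  (@qalg_scaleAr K F par_rel).

Definition par (g : G) : par_algebra := qmod_pi (ideal_gen par_rel) <[g]>.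
Definition par_e (g : G) : par_algebra := par g * par g^-1%g.

Let pi : F -> par_algebra := qmod_pi (ideal_gen par_rel).

Let piM x y : pi (x * y) = pi x * pi y.
Proof. exact/esym/qalg_mul_pi. Qed.

Let pi_rel x y : par_rel (x - y) -> pi x = pi y.
Proof.
move=> xy; apply/qmod_piP; apply: span_gen.
by exists 1, (x - y), 1; rewrite mulr1 mul1r.
Qed.

Lemma parMV g h : par g * par h * par h^-1%g = par (g * h)%g * par h^-1%g.
Proof. by have := pi_rel (ParRelR g h); rewrite !piM. Qed.

Lemma parVM g h : par g^-1%g * par g * par h = par g^-1%g * par (g * h)%g.
Proof. by have := pi_rel (ParRelL g h); rewrite !piM. Qed.

Lemma par1 : par 1%g = 1.
Proof. exact: (pi_rel ParRel1). Qed.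

Lemma parK g : par g * par g^-1%g * par g = par g.
Proof. by have := parMV g g^-1%g; rewrite invgK mulgV par1 mul1r. Qed.

Lemma par_eM g h : par g * par_e h = par_e (g * h)%g * par g.
Proof.
rewrite /par_e mulrA parMV -[par (g * h)%g in LHS]parK -!mulrA; congr (_ * _).
by have := parVM (g * h)%g h^-1%g; rewrite mulgK -!mulrA.
Qed.

Lemma par_eC g h : par_e g * par_e h = par_e h * par_e g.
Proof.
rewrite {1}/par_e -mulrA par_eM mulrA par_eM mulVKg -!mulrA.
by rewrite [par g * _]/(par_e g).
Qed.

Lemma par_e_idem g : par_e g * par_e g = par_e g.
Proof. by rewrite /par_e mulrA parK. Qed.

(* Right action of K_par G on itself with x^[g] = [g^-1] x [g], extended to words
   by x^([g][h]) = (x^[g])^[h]; it stabilises the subalgebra B below.  This is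
   not right multiplication. *)
Fixpoint word_act (w : seq G) (x : par_algebra) : par_algebra :=
  if w is g :: w' then word_act w' (par g^-1%g * x * par g) else x.

Definition free_act (x : par_algebra) : F -> par_algebra :=
  monalg_lift (fun w : free_monoid G => word_act w x).

HB.instance Definition _ x := GRing.Linear.on (free_act x).

Let word_act_is_linear w : linear (word_act w).
Proof.
elim: w => [|g w IHw] k x y //=.
by rewrite mulrDr mulrDl -scalerAr -scalerAl IHw.
Qed.

Let free_act_is_linear a : linear (free_act^~ a).
Proof.
move=> k x y; rewrite /free_act /monalg_lift !malg_liftE scaler_sumr -big_split.
apply: eq_bigr => w _ /=; rewrite word_act_is_linear scalerDr !scalerA.
by rewrite mulrC.
Qed.

Let free_act0 a : free_act 0 a = 0.
Proof.
by have := free_act_is_linear a (-1) 0 0; rewrite !scaleN1r addr0 oppr0 addNr.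
Qed.

Let free_actX x w : free_act x (monalgX K w) = word_act w x.
Proof. exact: monalg_liftX. Qed.

Let word_act_cat v w x : word_act (v ++ w) x = word_act w (word_act v x).
Proof. by elim: v x => //= g v IHv x. Qed.

Let free_actD x a b : free_act x (a + b) = free_act x a + free_act x b.
Proof. exact: linearD. Qed.
Let free_actZ x k a : free_act x (k *: a) = k *: free_act x a.
Proof. exact: linearZ_LR. Qed.
Let free_actr0 x : free_act x 0 = 0.
Proof. exact: linear0. Qed.
Let free_actDl x y a : free_act (x + y) a = free_act x a + free_act y a.
Proof. by have := free_act_is_linear a 1 x y; rewrite !scale1r. Qed.
Let free_actZl k x a : free_act (k *: x) a = k *: free_act x a.
Proof. by have := free_act_is_linear a k x 0; rewrite free_act0 !addr0. Qed.

Let free_actM x a b : free_act x (a * b) = free_act (free_act x a) b.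
Proof.
move: a; apply: monalg_ind => [|a1 a2 e1 e2|k a e|v].
- by rewrite mul0r !free_actr0 free_act0.
- by rewrite mulrDl !free_actD e1 e2 free_actDl.
- by rewrite -scalerAl !free_actZ e free_actZl.
move: b; apply: monalg_ind => [|a1 a2 e1 e2|k a e|w].
- by rewrite mulr0 !free_actr0.
- by rewrite mulrDr !free_actD e1 e2.
- by rewrite -scalerAr !free_actZ e.
by rewrite -monalgXM !free_actX word_act_cat.
Qed.

Let free_act1 x : free_act x 1 = x.
Proof. by rewrite -(monalgX1 K (free_monoid G)) free_actX. Qed.

Let free_act_gen x g : free_act x <[g]> = par g^-1%g * x * par g.
Proof. exact: free_actX. Qed.

Let free_act_rel x r : par_rel r -> free_act x r = 0.
Proof.
case=> [g h|g h|]; apply/eqP; rewrite linearB subr_eq0 /= ?free_actM;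
  rewrite ?free_act_gen ?free_act1; apply/eqP.
- have e : par h * par h^-1%g * par g^-1%g = par h * par (g * h)^-1%g.
    by have := parVM h^-1%g g^-1%g; rewrite invgK invgM.
  by rewrite invgK !mulrA e -!mulrA [par g * _]mulrA parMV.
- have e : par h^-1%g * par g^-1%g * par g = par (g * h)^-1%g * par g.
    by have := parMV h^-1%g g^-1%g; rewrite invgK invgM.
  by rewrite invgK !mulrA e -!mulrA [par g^-1%g * (par g * _)]mulrA parVM.
by rewrite invg1 par1 mul1r mulr1.
Qed.

Fact par_act_subproof x a : ideal_gen par_rel a -> free_act x a = 0.
Proof.
move=> [b [r [c [rr ->]]]].
by rewrite !free_actM (free_act_rel _ rr) free_act0.
Qed.

Definition par_act (x a : par_algebra) : par_algebra :=
  qmod_lift (par_act_subproof x) a.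

Fact par_act_is_linear x : linear (par_act x).
Proof. exact: linearP. Qed.

HB.instance Definition _ (x : par_algebra) :=
  GRing.isLinear.Build K par_algebra par_algebra *:%R (par_act x)
    (par_act_is_linear x).

Let par_act_pi x a : par_act x (pi a) = free_act x a.
Proof. exact: qmod_lift_pi. Qed.

Lemma par_act_par x g : par_act x (par g) = par g^-1%g * x * par g.
Proof. by rewrite par_act_pi free_act_gen. Qed.

Lemma par_act1 x : par_act x 1 = x.
Proof. by rewrite par_act_pi free_act1. Qed.

Lemma par_actM x a b : par_act x (a * b) = par_act (par_act x a) b.
Proof.
rewrite -(qmod_reprK a) -(qmod_reprK b) -[qmod_pi _ _]/(pi _).
rewrite -[X in _ = par_act _ X]/(pi _) -[X in pi _ * X]/(pi _) -piM.
by rewrite !par_act_pi free_actM.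
Qed.

Lemma par_act_linear a : linear (par_act^~ a).
Proof. by move=> k x y; apply: free_act_is_linear. Qed.

Lemma par_algebra_ind (P : par_algebra -> Prop) : P 1 ->
  (forall x y, P x -> P y -> P (x + y)) -> (forall k x, P x -> P (k *: x)) ->
  (forall x g, P x -> P (x * par g)) -> forall x, P x.
Proof.
move=> P1 PD PZ PM x; rewrite -(qmod_reprK x) -[qmod_pi _ _]/(pi _).
move: (qmod_repr x); apply: monalg_ind => [|a b Pa Pb|k a Pa|w].
- by rewrite (linear0 (qmod_pi _) : pi 0 = 0) -(scale0r (1 : par_algebra)); apply: PZ.
- by rewrite (linearD (qmod_pi _) a b : pi (a + b) = pi a + pi b); apply: PD.
- by rewrite (linearZ_LR (qmod_pi _) k a : pi (k *: a) = k *: pi a); apply: PZ.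
elim/last_ind: w => [|w g Pw]; first exact: P1.
have -> : monalgX K (rcons w g : free_monoid G) =
    monalgX K (w : free_monoid G) * <[g]>.
  by rewrite -monalgXM -cats1.
by rewrite piM; apply: PM.
Qed.

(* Membership in the unital subalgebra generated by the par_e g. *)
Inductive in_B : par_algebra -> Prop :=
| in_B_e g : in_B (par_e g)
| in_B_1 : in_B 1
| in_B_D x y of in_B x & in_B y : in_B (x + y)
| in_B_Z (k : K) x of in_B x : in_B (k *: x)
| in_B_M x y of in_B x & in_B y : in_B (x * y).

Definition B_pred : {pred par_algebra} := fun x => `[< in_B x >].

Lemma B_predP x : reflect (in_B x) (x \in B_pred).
Proof. exact: asboolP. Qed.

Fact B_submod_closed : submod_closed B_pred.
Proof.
split=> [|k x y /B_predP xB /B_predP yB]; apply/B_predP.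
  by rewrite -(scale0r 1); apply: in_B_Z; apply: in_B_1.
by apply: in_B_D => //; apply: in_B_Z.
Qed.

HB.instance Definition _ :=
  GRing.isSubmodClosed.Build K par_algebra B_pred B_submod_closed.

Record par_B : Type := ParB { par_B_val : par_algebra; _ : par_B_val \in B_pred }.

HB.instance Definition _ := [isSub for par_B_val].
HB.instance Definition _ := [Choice of par_B by <:].
HB.instance Definition _ := [SubChoice_isSubZmodule of par_B by <:].

Let in_B_eC x g : in_B x -> par_e g * x = x * par_e g.
Proof.
elim=> [h||y z _ ey _ ez|k y _ ey|y z _ ey _ ez].
- exact: par_eC.
- by rewrite mulr1 mul1r.
- by rewrite mulrDr mulrDl ey ez.
- by rewrite -scalerAr -scalerAl ey.
by rewrite mulrA ey -(mulrA y) ez mulrA.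
Qed.

Let conj_mul (A : nzRingType) (a b y z : A) :
  a * b * a = a -> b * a * y = y * (b * a) ->
  a * (y * z) * b = a * y * b * (a * z * b).
Proof.
move=> ha hy; have -> : a * y * b * (a * z * b) = a * (y * (b * a)) * z * b.
  by rewrite !mulrA.
by rewrite -hy !mulrA ha.
Qed.

Let in_B_conj x g : in_B x -> in_B (par g^-1%g * x * par g).
Proof.
have eV : par g^-1%g * par g = par_e g^-1%g by rewrite /par_e invgK.
elim=> [h||y z _ yB _ zB|k y _ yB|y z yB' yB zB' zB].
- by rewrite par_eM -mulrA eV; apply: in_B_M; apply: in_B_e.
- by rewrite mulr1 eV; apply: in_B_e.
- by rewrite mulrDr mulrDl; apply: in_B_D.
- by rewrite -scalerAr -scalerAl; apply: in_B_Z.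
rewrite (@conj_mul _ (par g^-1%g) (par g)); first exact: in_B_M.
  by have := parK g^-1%g; rewrite invgK.
exact: in_B_eC.
Qed.

Fact par_act_in_B x a : in_B x -> in_B (par_act x a).
Proof.
move=> xB; move: a; apply: par_algebra_ind => [|a b aB bB|k a aB|a g aB].
- by rewrite par_act1.
- by rewrite linearD; apply: in_B_D.
- by rewrite linearZ; apply: in_B_Z.
by rewrite par_actM par_act_par; apply: in_B_conj.
Qed.

Fact par_B_act_subproof (b : par_B) a : par_act (val b) a \in B_pred.
Proof. by apply/B_predP/par_act_in_B/B_predP; case: b. Qed.

Definition par_B_act (a : par_algebra^c) (b : par_B) : par_B :=
  ParB (par_B_act_subproof b a).

Fact par_B_scalerA a a' b :
  par_B_act a (par_B_act a' b) = par_B_act (a * a') b.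
Proof. by apply: val_inj; rewrite /= -par_actM. Qed.

Fact par_B_scale1r : left_id 1 par_B_act.
Proof. by move=> b; apply: val_inj; rewrite /= par_act1. Qed.

Fact par_B_scalerDr : right_distributive par_B_act +%R.
Proof.
move=> a b b'; apply: val_inj => /=.
by have := par_act_linear a 1 (val b) (val b'); rewrite !scale1r.
Qed.

Fact par_B_scalerDl b : {morph par_B_act^~ b : a a' / a + a'}.
Proof. by move=> a a'; apply: val_inj; rewrite /= linearD. Qed.

HB.instance Definition _ := GRing.Zmodule_isLmodule.Build par_algebra^c par_B
  par_B_scalerA par_B_scale1r par_B_scalerDr par_B_scalerDl.

Lemma par_B_scale_par (b : par_B) g :
  val ((par g : par_algebra^c) *: b) = par g^-1%g * val b * par g.
Proof. exact: par_act_par. Qed.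

End PartialGroupAlgebra.

Arguments par K {G} g.
Arguments par_e K {G} g.

Definition trivial_module (K : fieldType) (H : groupType) : Type := K.

Section TrivialModule.
Variables (K : fieldType) (H : groupType).
Local Notation KH := (group_algebra K H).
Local Notation T := (trivial_module K H).

HB.instance Definition _ := GRing.Zmodule.copy T K.

Definition augmentation (a : KH) : K := \sum_(h <- msupp a) a@_h.

Let augE a : augmentation a = monalg_lift (fun _ : H => 1 : K^o) a.
Proof.
rewrite /monalg_lift malg_liftE.
by apply: eq_bigr => h _; rewrite [RHS]mulr1.
Qed.

Let augD a b : augmentation (a + b) = augmentation a + augmentation b.
Proof. by rewrite !augE linearD. Qed.
Let augZ k a : augmentation (k *: a) = k * augmentation a.
Proof. by rewrite !augE linearZ. Qed.
Let aug0 : augmentation 0 = 0.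
Proof. by rewrite augE linear0. Qed.
Let augX (h : H) : augmentation (monalgX K h) = 1.
Proof. by rewrite augE monalg_liftX. Qed.

Let augM a b : augmentation (a * b) = augmentation a * augmentation b.
Proof.
move: a; apply: monalg_ind => [|x1 x2 e1 e2|k x e|v].
- by rewrite mul0r aug0 mul0r.
- by rewrite mulrDl !augD e1 e2 mulrDl.
- by rewrite -scalerAl !augZ e mulrA.
move: b; apply: monalg_ind => [|x1 x2 e1 e2|k x e|w].
- by rewrite mulr0 aug0 mulr0.
- by rewrite mulrDr !augD e1 e2 mulrDr.
- by rewrite -scalerAr !augZ e mulrCA.
by rewrite -monalgXM !augX mulr1.
Qed.

Definition trivial_act (a : KH^c) (x : T) : T := x * augmentation a.

Fact trivial_scalerA a b x :
  trivial_act a (trivial_act b x) = trivial_act (a * b) x.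
Proof. by rewrite /trivial_act -mulrA -augM. Qed.

Fact trivial_scale1r : left_id 1 trivial_act.
Proof. by move=> x; rewrite /trivial_act augX mulr1. Qed.

Fact trivial_scalerDr : right_distributive trivial_act +%R.
Proof. by move=> a x y; rewrite /trivial_act mulrDl. Qed.

Fact trivial_scalerDl x : {morph trivial_act^~ x : a b / a + b}.
Proof. by move=> a b; rewrite /trivial_act augD mulrDr. Qed.

HB.instance Definition _ := GRing.Zmodule_isLmodule.Build KH^c T
  trivial_scalerA trivial_scale1r trivial_scalerDr trivial_scalerDl.

End TrivialModule.

Definition par_homology (K : fieldType) (G : groupType) (n : nat)
    (V : lmodType (par_algebra K G)) (P : projective_resolution V) :
  lmodType K := Tor n (par_B K G) P.

Definition group_homology (K : fieldType) (H : groupType) (n : nat)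
    (U : lmodType (group_algebra K H)) (P : projective_resolution U) :
  lmodType K := Tor n (trivial_module K H) P.

(* Main.v *)
Require Import Defs.
From HB Require Import structures.
From mathcomp Require Import all_boot all_order all_algebra.
From mathcomp Require Import boolp.
From mathcomp Require Import finmap monalg.

(** Let A be the partial group algebra of G and S the group algebra of H, and
    let Q be a projective resolution of U over S.  Since W is flat over S, the
    complex W (x) Q is a resolution of W (x) U.  Its terms are flat over A:
    tensoring with W (x) Q_n is tensoring with W and then with Q_n, and both
    functors are exact.  Hence Tor^A(B, W (x) U) is the homology of
    B (x) (W (x) Q) = (B (x) W) (x) Q, which is K (x) Q by the hypothesis on
    B (x) W, and this is the complex computing the homology of H in U.  The
    argument is carried out for a bimodule over any two algebras
    ([Tor_bimod_tensor]).

    The point that needs an argument is that a flat resolution computes the same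
    Tor as a projective one ([flat_resolutions_homology]).  It is obtained by
    shifting dimensions in the right-hand module M and not in V.  Given a flat
    presentation 0 -> M' -> L -> M -> 0 and a flat resolution C of V, tensoring
    with C gives a short exact sequence of complexes whose middle term is
    acyclic in positive degrees, so the connecting homomorphism identifies
    H_(n+1)(M (x) C) with H_n(M' (x) C), or, for n = 0, with the kernel of
    H_0(M' (x) C) -> H_0(L (x) C), that is of M' (x) V -> L (x) V.  Iterating
    describes H_n(M (x) C) by M and V alone, so any two flat resolutions of V
    agree.  The connecting homomorphism is handled as a linear relation on
    chains ([connecting]) and only turned into an isomorphism at the end
    ([homology_isomorphic_of_rel]).

    Flatness of projective left modules and of free right modules both come from
    writing a tensor as the sum of its coordinates along a dual basis
    ([exact_seq_of_coordinates]). *)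

Set Implicit Arguments.
Unset Strict Implicit.
Unset Printing Implicit Defensive.

Import GRing.Theory.
Local Open Scope ring_scope.

(** * Isomorphisms of homology from linear relations *)

Section LinearRelations.
Variable R : pzRingType.

Definition linear_rel (V W : lmodType R) (rho : V -> W -> Prop) : Prop :=
  forall a v w v' w', rho v w -> rho v' w' -> rho (a *: v + v') (a *: w + w').

(** Diagram chases produce relations, not functions: they are linear, total on
    both sides, and relate zero only to zero.  The last condition makes such a
    relation single-valued and injective, so any choice of values is a linear
    bijection. *)
Lemma isomorphic_of_rel (V W : lmodType R) (rho : V -> W -> Prop) :
  linear_rel rho ->
  (forall v, exists w, rho v w) -> (forall w, exists v, rho v w) ->
  (forall v w, rho v w -> v = 0 <-> w = 0) ->
  isomorphic V W.
Proof.
move=> rhoP /choice[f fP] /choice[g gP] rho0.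
have rhoB v w v' w' : rho v w -> rho v' w' -> rho (v - v') (w - w').
  move=> h h'; rewrite addrC [w - w']addrC -[- v']scaleN1r -[- w']scaleN1r.
  exact: rhoP.
have funct v w : rho v w -> f v = w.
  move=> /(rhoB _ _ _ _ (fP v)) h; apply/eqP; rewrite -subr_eq0; apply/eqP.
  by apply/(rho0 _ _ h); rewrite subrr.
have inj v v' w : rho v w -> rho v' w -> v = v'.
  move=> h h'; apply/eqP; rewrite -subr_eq0; apply/eqP.
  by apply/(rho0 _ _ (rhoB _ _ _ _ h h')); rewrite subrr.
have flin : linear f by move=> a v v'; apply/funct/rhoP; apply: fP.
pose fL := HB.pack_for {linear V -> W} f
  (GRing.isLinear.Build R V W *:%R f flin).
exists fL; exists g => [v|w]; last exact/funct/gP.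
exact: (inj _ _ (f v)).
Qed.

Lemma isomorphic_trans (U V W : lmodType R) :
  isomorphic U V -> isomorphic V W -> isomorphic U W.
Proof.
by move=> [f bf] [g bg]; exists (g \o f : {linear U -> W}); exact: bij_comp.
Qed.

(** The homology module is a quotient by a span; the boundaries are already a
    submodule. *)
Lemma in_span_boundary (C : nat -> lmodType R)
    (d : forall n, {linear C n.+1 -> C n}) n (z : cycles d n) :
  in_span (@boundary R C d n) z <-> exists y, cycle_val z = d n y.
Proof.
split=> [|zB]; last exact: span_gen.
elim=> {z} [z //||y z _ [u yu] _ [v zv]|a z _ [u zu]].
- by exists 0; rewrite linear0.
- by exists (u + v); rewrite linearD -yu -zv.
by exists (a *: u); rewrite linearZ -zu.
Qed.

Section HomologyRel.
Variables (C D : nat -> lmodType R).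
Variables (d : forall n, {linear C n.+1 -> C n}).
Variables (e : forall n, {linear D n.+1 -> D n}).

(** A chase between two complexes descends to homology once it matches the
    boundaries: this is the vanishing condition of [isomorphic_of_rel] for the
    induced relation on classes. *)
Lemma homology_isomorphic_of_rel n (rho : C n -> D n -> Prop) :
  linear_rel rho ->
  (forall x, x \in @cycle_pred R C d n ->
     exists y, y \in @cycle_pred R D e n /\ rho x y) ->
  (forall y, y \in @cycle_pred R D e n ->
     exists x, x \in @cycle_pred R C d n /\ rho x y) ->
  (forall x y, rho x y -> (exists u, x = d n u) <-> (exists v, y = e n v)) ->
  isomorphic (homology d n) (homology e n).
Proof.
move=> rhoP tot surj bd.
pose tau (p : homology d n) (q : homology e n) :=
  exists x y, [/\ qmod_pi _ x = p, qmod_pi _ y = q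
                & rho (cycle_val x) (cycle_val y)].
apply: (@isomorphic_of_rel _ _ tau).
- move=> a p q p' q' [x [y [<- <- xy]]] [x' [y' [<- <- xy']]].
  exists (a *: x + x'), (a *: y + y'); split; rewrite ?linearP //.
  exact: (rhoP a _ _ _ _ xy xy').
- move=> p; rewrite -(qmod_reprK p); case: (qmod_repr p) => x xZ.
  have [y [yZ xy]] := tot x xZ.
  by exists (qmod_pi _ (Cycle yZ)), (Cycle xZ), (Cycle yZ).
- move=> q; rewrite -(qmod_reprK q); case: (qmod_repr q) => y yZ.
  have [x [xZ xy]] := surj y yZ.
  by exists (qmod_pi _ (Cycle xZ)), (Cycle xZ), (Cycle yZ).
move=> p q [x [y [<- <- xy]]].
by rewrite !qmod_pi_eq0 (in_span_boundary x) (in_span_boundary y); exact: bd.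
Qed.

Lemma homology_isomorphic_of_bij n (f : forall m, {linear C m -> D m}) :
  (forall m, bijective (f m)) -> (forall m x, f m (d m x) = e m (f m.+1 x)) ->
  isomorphic (homology d n) (homology e n).
Proof.
move=> fbij fd; pose rho (x : C n) y := f n x = y.
have cyc x : (f n x \in @cycle_pred R D e n) = (x \in @cycle_pred R C d n).
  case: n {rho} x => [|n] x //; rewrite !unfold_in /= -fd.
  apply/eqP/eqP => [|->]; last by rewrite linear0.
  by move=> fdx; apply: (bij_inj (fbij n)); rewrite fdx raddf0.
apply: (@homology_isomorphic_of_rel _ rho); rewrite /rho.
- by move=> a x _ x' _ <- <-; rewrite linearP.
- by move=> x xZ; exists (f n x); rewrite cyc.
- by move=> y yZ; have [g _ gK] := fbij n; exists (g y); rewrite -cyc gK.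
move=> x _ <-; split=> [[u ->]|[v fxv]]; first by exists (f n.+1 u); rewrite fd.
have [g _ gK] := fbij n.+1; exists (g v); apply: (bij_inj (fbij n)).
by rewrite fd gK.
Qed.

End HomologyRel.
End LinearRelations.

(** * Tensor products and exactness *)

(** The coordinate maps of a tensor product take values in a module over the
    algebra itself; restricting scalars to the ground field along [phi] makes
    them maps of vector spaces, for left and for right modules alike. *)
Definition scalar_restriction (K S : pzRingType) (phi : {rmorphism K -> S})
  (M : lmodType S) : Type := M.

Section ScalarRestriction.
Variables (K S : pzRingType) (phi : {rmorphism K -> S}) (M : lmodType S).
Local Notation T := (scalar_restriction phi M).

HB.instance Definition _ := GRing.Zmodule.on T.

Let scale (k : K) (m : T) : T := phi k *: (m : M).

Let scaleA k l m : scale k (scale l m) = scale (k * l) m.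
Proof. by rewrite /scale scalerA rmorphM. Qed.
Let scale1 : left_id 1 scale.
Proof. by move=> m; rewrite /scale rmorph1 scale1r. Qed.
Let scaleDr : right_distributive scale +%R.
Proof. by move=> k m m'; rewrite /scale scalerDr. Qed.
Let scaleDl m : {morph scale^~ m : k l / k + l}.
Proof. by move=> k l; rewrite /scale rmorphD scalerDl. Qed.

HB.instance Definition _ :=
  GRing.Zmodule_isLmodule.Build K T scaleA scale1 scaleDr scaleDl.

Lemma scalar_restrictionE (k : K) (m : T) : k *: m = phi k *: (m : M).
Proof. by []. Qed.

End ScalarRestriction.

(** Right modules are modules over the converse ring, for which the scalars
    have to be embedded by hand. *)
Section ConverseInAlg.
Variables (K : comNzRingType) (R : algType K).

Definition converse_in_alg (k : K) : R^c := (k%:A : R).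

Fact converse_in_alg_is_zmod_morphism : zmod_morphism converse_in_alg.
Proof. by move=> k l; rewrite /converse_in_alg scalerBl. Qed.
Fact converse_in_alg_is_monoid_morphism : monoid_morphism converse_in_alg.
Proof.
split=> [|k l]; first by rewrite /converse_in_alg scale1r.
rewrite -[RHS]/((l%:A : R) * k%:A) /converse_in_alg.
by rewrite -scalerAl mul1r scalerA mulrC.
Qed.

HB.instance Definition _ := GRing.isZmodMorphism.Build K R^c converse_in_alg
  converse_in_alg_is_zmod_morphism.
HB.instance Definition _ := GRing.isMonoidMorphism.Build K R^c converse_in_alg
  converse_in_alg_is_monoid_morphism.

End ConverseInAlg.

Section TensorExactness.
Variables (K : fieldType) (R : algType K).

Lemma tens0r (M : lmodType R^c) (N : lmodType R) (m : M) :
  tens m (0 : N) = 0.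
Proof. by rewrite -(scale0r (0 : N)) -(scale0r (1 : R)) tensZr scale0r. Qed.

Lemma tens0l (M : lmodType R^c) (N : lmodType R) (n : N) :
  tens (0 : M) n = 0.
Proof. by rewrite -(scale0r (0 : M)) tens_bal scale0r tens0r. Qed.

Lemma tens_sumr (M : lmodType R^c) (N : lmodType R) (m : M) I (r : seq I)
    (P : pred I) (F : I -> N) :
  tens m (\sum_(i <- r | P i) F i) = \sum_(i <- r | P i) tens m (F i).
Proof.
by apply: (big_morph (tens m)) => [x y|]; [exact: tensDr|exact: tens0r].
Qed.

Lemma tens_suml (M : lmodType R^c) (N : lmodType R) (n : N) I (r : seq I)
    (P : pred I) (F : I -> M) :
  tens (\sum_(i <- r | P i) F i) n = \sum_(i <- r | P i) tens (F i) n.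
Proof.
by apply: (big_morph (tens^~ n)) => [x y|]; [exact: tensDl|exact: tens0l].
Qed.

Lemma tensor_map_comp (M M' M'' : lmodType R^c) (N N' N'' : lmodType R)
    (f : {linear M -> M'}) (f' : {linear M' -> M''})
    (g : {linear N -> N'}) (g' : {linear N' -> N''}) t :
  tensor_map f' g' (tensor_map f g t) = tensor_map (f' \o f) (g' \o g) t.
Proof.
move: t; apply: tensor_ind => [|x y ex ey|m n].
- by rewrite !linear0.
- by rewrite !linearD /= ex ey.
by rewrite !tensor_map_tens.
Qed.

Lemma eq_tensor_map (M M' : lmodType R^c) (N N' : lmodType R)
    (f f' : {linear M -> M'}) (g g' : {linear N -> N'}) :
  f =1 f' -> g =1 g' -> tensor_map f g =1 tensor_map f' g'.
Proof.
move=> ff' gg'; apply: tensor_ind => [|x y ex ey|m n].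
- by rewrite !linear0.
- by rewrite !linearD /= ex ey.
by rewrite !tensor_map_tens ff' gg'.
Qed.

Lemma tensor_mapC (M M' : lmodType R^c) (N N' : lmodType R)
    (f : {linear M -> M'}) (g : {linear N -> N'}) t :
  tensor_map (idfun : {linear M' -> M'}) g
    (tensor_map f (idfun : {linear N -> N}) t) =
  tensor_map f (idfun : {linear N' -> N'})
    (tensor_map (idfun : {linear M -> M}) g t).
Proof. by rewrite !tensor_map_comp; apply: eq_tensor_map. Qed.

Lemma tensor_map_comp0 (M M' M'' : lmodType R^c) (N N' N'' : lmodType R)
    (f : {linear M -> M'}) (f' : {linear M' -> M''})
    (g : {linear N -> N'}) (g' : {linear N' -> N''}) :
  (forall m, f' (f m) = 0) \/ (forall n, g' (g n) = 0) ->
  forall t, tensor_map f' g' (tensor_map f g t) = 0.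
Proof.
move=> fg0; apply: tensor_ind => [|x y ex ey|m n].
- by rewrite !linear0.
- by rewrite !linearD /= ex ey addr0.
rewrite !tensor_map_tens; case: fg0 => ->; first exact: tens0l.
exact: tens0r.
Qed.

Lemma tensor_map_surj (M M' : lmodType R^c) (N N' : lmodType R)
    (f : {linear M -> M'}) (g : {linear N -> N'}) :
  surjective f -> surjective g -> surjective (tensor_map f g).
Proof.
move=> fs gs; apply: tensor_ind => [|_ _ [x <-] [y <-]|m n].
- by exists 0; rewrite linear0.
- by exists (x + y); rewrite linearD.
have [[m' <-] [n' <-]] := (fs m, gs n).
by exists (tens m' n'); rewrite tensor_map_tens.
Qed.

(** Sending [m (x) n] to the class of [m (x) n'], for any [n'] above [n], is
    well defined modulo the image of [M (x) N1], and it inverts the map from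
    that cokernel to [M (x) N3].  Hence only the image is killed. *)
Lemma tensor_map_right_exact (M : lmodType R^c) (N1 N2 N3 : lmodType R)
    (f : {linear N1 -> N2}) (g : {linear N2 -> N3}) :
  surjective g -> exact_seq f g ->
  exact_seq (tensor_map (idfun : {linear M -> M}) f)
            (tensor_map (idfun : {linear M -> M}) g).
Proof.
move=> gs fg.
have gf x : g (f x) = 0 by apply/fg; exists x.
set F := tensor_map _ f; set G := tensor_map _ g.
move=> t; split=> [Gt|[x <-]]; last first.
  move: x; apply: tensor_ind => [|x y ex ey|m n].
  - by rewrite /F /G !linear0.
  - by rewrite /F /G !linearD /= -/F -/G ex ey addr0.
  by rewrite /F /G !tensor_map_tens /= gf tens0r.
pose im (x : tensor M N2) := exists y, x = F y.
have imP x : in_span im x <-> im x.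
  split=> [|xi]; last exact: span_gen.
  elim=> {x} [//||x y _ [u ->] _ [v ->]|a x _ [u ->]].
  - by exists 0; rewrite /F linear0.
  - by exists (u + v); rewrite /F linearD.
  by exists (a *: u); rewrite /F linearZ.
have [s sK] := choice gs.
have pi_ker m n : g n = 0 -> qmod_pi im (tens m n) = 0.
  move=> /fg[n' <-]; apply/qmod_pi_eq0/imP; exists (tens m n').
  by rewrite /F tensor_map_tens.
pose b m n := qmod_pi im (tens m (s n)).
have bE m n n' : g n = n' -> b m n' = qmod_pi im (tens m n).
  move=> gn; rewrite /b -[s n'](subrK n) tensDr linearD /= pi_ker ?add0r //.
  by rewrite linearB /= sK gn subrr.
have bb : balanced_bilinear b.
  split=> [m m' n|m n n'|m r n|k m n].
  - by rewrite /b tensDl linearD.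
  - by rewrite (bE _ (s n + s n')) ?tensDr ?linearD // !sK.
  - by rewrite (bE m (r *: s n)) ?linearZ /= ?sK // -tens_bal.
  by rewrite (bE _ (k%:A *: s n)) ?tensZr ?linearZ /= ?sK.
have bG x : tensor_lift bb (G x) = qmod_pi im x.
  move: x; apply: tensor_ind => [|x y ex ey|m n].
  - by rewrite /G !linear0.
  - by rewrite /G !linearD /= -/G ex ey.
  by rewrite /G tensor_map_tens tensor_lift_tens /=; apply: bE.
have /qmod_pi_eq0/imP[y ->] : qmod_pi im t = 0 by rewrite -bG Gt linear0.
by exists y.
Qed.

Lemma flat_left_inj (N : lmodType R) (M M' : lmodType R^c)
    (f : {linear M -> M'}) :
  flat_left N -> injective f ->
  injective (tensor_map f (idfun : {linear N -> N})).
Proof.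
move=> Nflat fI; apply: raddf_inj => t.
(* Injectivity of [f] is exactness of the zero map followed by [f]. *)
have f0 : exact_seq (\0 : {linear M -> M}) f.
  move=> m; split=> [fm|[x <-]]; last by rewrite linear0.
  by exists 0; apply: fI; rewrite fm linear0.
move=> /(Nflat _ _ _ _ _ f0)[x <-]; move: x.
apply: tensor_ind => [|x y ex ey|m n]; first exact: linear0.
  by rewrite linearD /= ex ey addr0.
by rewrite tensor_map_tens /= tens0l.
Qed.

End TensorExactness.

(** * Flatness from dual bases *)

Section DualBasis.

(** Exactness is checked coordinatewise: if the image of [t] vanishes then so
    do its coordinates, each coordinate of [t] then lifts along [f], and the
    finitely many lifts that matter are reassembled into a preimage of [t].
    This is the common core of both flatness statements below. *)
Lemma exact_seq_of_coordinates (X : Type) (T1 T2 T3 N1 N2 N3 : zmodType)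
    (F : {additive T1 -> T2}) (G : {additive T2 -> T3})
    (f : N1 -> N2) (g : N2 -> N3)
    (c2 : X -> T2 -> N2) (c3 : X -> T3 -> N3)
    (i1 : X -> N1 -> T1) (i2 : X -> N2 -> T2) :
  (forall t, G (F t) = 0) -> exact_seq f g ->
  (forall x, c3 x 0 = 0) -> (forall x t, g (c2 x t) = c3 x (G t)) ->
  (forall x n, F (i1 x n) = i2 x (f n)) ->
  (forall t, exists d : seq X, t = \sum_(x <- d) i2 x (c2 x t)) ->
  exact_seq F G.
Proof.
move=> GF fg c30 gc Fi t2E t; split=> [Gt|[t1 <-]]; last exact: GF.
have /choice[u uE] x : exists n, f n = c2 x t by apply/fg; rewrite gc Gt.
have [d {1}->] := t2E t; exists (\sum_(x <- d) i1 x (u x)).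
by rewrite raddf_sum; apply: eq_bigr => x _; rewrite Fi uE.
Qed.

Variables (K : fieldType) (R : algType K).

(** The family [e] together with the coordinate forms of [s] is a dual basis of
    [N]: the map [m (x) n |-> m . (s n)_x] is the [x]-coordinate of a tensor
    [t], and [t] is the sum over [x] of its [x]-coordinate tensored with
    [e x]. *)
Lemma flat_left_of_dual_basis (N : lmodType R) (X : choiceType) (e : X -> N)
    (s : {linear N -> {malg R[X]}}) :
  (forall n, malg_lift e (s n) = n) -> flat_left N.
Proof.
move=> sK.
have bb (M : lmodType R^c) x : balanced_bilinear
    (fun (m : M) n =>
      ((s n)@_x : R^c) *: m : scalar_restriction (@converse_in_alg K R) M).
  split=> [m m' n|m n n'|m r n|k m n].
  - by rewrite scalerDr.
  - by rewrite linearD mcoeffD scalerDl.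
  - by rewrite linearZ /= mcoeffZ scalerA.
  rewrite linearZ /= mcoeffZ scalar_restrictionE scalerA.
  apply: (congr1 (fun r : R^c => r *: m)).
  by rewrite -[RHS]/((s n)@_x * k%:A) -scalerAl -scalerAr mul1r mulr1.
pose c (M : lmodType R^c) x :
    {linear tensor M N -> scalar_restriction (@converse_in_alg K R) M} :=
  tensor_lift (bb M x).
have cE M x m n : c M x (tens m n) = ((s n)@_x : R^c) *: m.
  exact: tensor_lift_tens.
move=> M1 M2 M3 f g fg.
have gc x t : g (c M2 x t) = c M3 x (tensor_map g (idfun : {linear N -> N}) t).
  move: t; apply: tensor_ind => [|t t' et et'|m n].
  - by rewrite !linear0.
  - by rewrite !linearD /= et et'.
  by rewrite tensor_map_tens !cE linearZ.
apply: (@exact_seq_of_coordinates X _ _ _ M1 M2 M3 (tensor_map f idfun)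
  (tensor_map g idfun) f g (c M2) (c M3)
  (fun x m => tens m (e x)) (fun x m => tens m (e x))) => //.
- by apply: tensor_map_comp0; left=> m; apply/fg; exists m.
- by move=> x; exact: linear0.
- by move=> x m; exact: tensor_map_tens.
move=> t.
(* Quantifying over all larger supports makes the claim stable under sums. *)
suff [d dP] : exists d : {fset X}, forall d' : {fset X}, (d `<=` d')%fset ->
    t = \sum_(x <- d') tens (c M2 x t : M2) (e x).
  by exists d; apply: dP.
move: t; apply: tensor_ind => [|t t' [d dP] [d' dP']|m n].
- exists fset0 => d _; rewrite big1 // => x _.
  by rewrite linear0; exact: tens0l.
- exists (d `|` d')%fset => d'' /[!fsubUset] /andP[dd dd'].
  rewrite {1}(dP _ dd) {1}(dP' _ dd') -big_split; apply: eq_bigr => x _ /=.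
  by rewrite linearD; symmetry; apply: tensDl.
exists (msupp (s n)) => d nd.
rewrite -{1}(sK n) (malg_liftEw _ nd) tens_sumr; apply: eq_bigr => x _.
by rewrite cE tens_bal.
Qed.

(** A section of the free cover of a projective module is a dual basis. *)
Lemma projective_flat_left (N : lmodType R) : projective N -> flat_left N.
Proof.
move=> Nproj.
have [s sK] := Nproj _ _ (@free_cover R N) (idfun : {linear N -> N})
  (@free_cover_surj R N).
exact: (flat_left_of_dual_basis (e := id) (s := s)).
Qed.

(** The basis of a free right module and the coefficient functions play the
    role of the dual basis above. *)
Lemma free_flat_right (X : choiceType) :
  flat_right ({malg R^c[X]} : lmodType R^c).
Proof.
pose L : lmodType R^c := {malg R^c[X]}.
have bb (N : lmodType R) x : balanced_bilinear
    (fun (l : L) (n : N) => (l@_x : R) *: n : scalar_restriction (in_alg R) N).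
  split=> [m m' n|m n n'|m r n|k l n].
  - by rewrite mcoeffD scalerDl.
  - by rewrite scalerDr.
  - by rewrite mcoeffZ scalerA.
  rewrite scalar_restrictionE !scalerA.
  apply: (congr1 (fun r : R => r *: n)).
  by rewrite -scalerAr mulr1 /= -scalerAl mul1r.
pose c (N : lmodType R) x :
    {linear tensor L N -> scalar_restriction (in_alg R) N} :=
  tensor_lift (bb N x).
have cE N x l n : c N x (tens l n) = ((l : L)@_x : R) *: n.
  exact: tensor_lift_tens.
move=> N1 N2 N3 f g fg.
have gc x t : g (c N2 x t) = c N3 x (tensor_map (idfun : {linear L -> L}) g t).
  move: t; apply: tensor_ind => [|t t' et et'|l n].
  - by rewrite !linear0.
  - by rewrite !linearD /= et et'.
  by rewrite tensor_map_tens !cE linearZ.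
apply: (@exact_seq_of_coordinates X _ _ _ N1 N2 N3 (tensor_map idfun f)
  (tensor_map idfun g) f g (c N2) (c N3)
  (fun x n => tens (<< x >> : L) n) (fun x n => tens (<< x >> : L) n)) => //.
- by apply: tensor_map_comp0; right=> m; apply/fg; exists m.
- by move=> x; exact: linear0.
- by move=> x m; exact: tensor_map_tens.
move=> t.
(* Quantifying over all larger supports makes the claim stable under sums. *)
suff [d dP] : exists d : {fset X}, forall d' : {fset X}, (d `<=` d')%fset ->
    t = \sum_(x <- d') tens (<< x >> : L) (c N2 x t : N2).
  by exists d; apply: dP.
move: t; apply: tensor_ind => [|t t' [d dP] [d' dP']|l n].
- exists fset0 => d _; rewrite big1 // => x _.
  by rewrite linear0; exact: tens0r.
- exists (d `|` d')%fset => d'' /[!fsubUset] /andP[dd dd'].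
  rewrite {1}(dP _ dd) {1}(dP' _ dd') -big_split; apply: eq_bigr => x _ /=.
  by rewrite linearD; symmetry; apply: tensDr.
exists (msupp l) => d nd.
rewrite {1}(monalgEw nd) tens_suml; apply: eq_bigr => x _.
by rewrite cE -tens_bal malgU_scale.
Qed.

End DualBasis.

(** * Dimension shifting *)

Section DimensionShift.
Variables (K : fieldType) (R : algType K).

(** A flat presentation [0 -> syz M -> cover M -> M -> 0] of every right
    module, so that the construction can be iterated. *)
Variables (syz cover : lmodType R^c -> lmodType R^c).
Variables (inc : forall M, {linear syz M -> cover M}).
Variables (proj : forall M, {linear cover M -> M}).
Hypothesis inc_inj : forall M, injective (inc M).
Hypothesis proj_surj : forall M, surjective (proj M).
Hypothesis inc_proj_exact : forall M, exact_seq (inc M) (proj M).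
Hypothesis cover_flat : forall M, flat_right (cover M).

Fixpoint syzygies (n : nat) (M : lmodType R^c) : lmodType R^c :=
  if n is m.+1 then syzygies m (syz M) else M.

Variable V : lmodType R.

(** The model of [Tor_n(M, V)], which mentions no resolution of [V]: all of
    [M (x) V] for [n = 0], and for [n > 0] the kernel of the map from
    [syz^n M (x) V] to [cover (syz^(n-1) M) (x) V].  The model of [M] in degree
    [m.+1] is that of [syz M] in degree [m], except for [m = 0]: tensoring
    [cover M] with a resolution of [V] leaves [cover M (x) V] in degree zero,
    which cuts [Tor_1] down to a kernel. *)
Fixpoint shifted_tor (n : nat) (M : lmodType R^c) :
    tensor (syzygies n M) V -> Prop :=
  match n return tensor (syzygies n M) V -> Prop with
  | 0 => fun _ => True
  | m.+1 =>
      match m return (tensor (syzygies m (syz M)) V -> Prop) ->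
        tensor (syzygies m (syz M)) V -> Prop with
      | 0 => fun _ v =>
          tensor_map (inc M) (idfun : {linear V -> V}) v = 0
      | _ => fun T => T
      end (shifted_tor (n := m) (M := syz M))
  end.

Variables (C : nat -> lmodType R) (d : forall n, {linear C n.+1 -> C n}).
Variable eps : {linear C 0 -> V}.
Hypothesis Cflat : forall n, flat_left (C n).
Hypothesis eps_surj : surjective eps.
Hypothesis exact0 : exact_seq (d 0) eps.
Hypothesis exactS : forall n, exact_seq (d n.+1) (d n).

Local Notation dT M n := (tensor_map (idfun : {linear M -> M}) (d n)).
Local Notation epsT M := (tensor_map (idfun : {linear M -> M}) eps).
Local Notation mapT f n := (tensor_map f (idfun : {linear C n -> C n})).

Lemma dT_dT (M : lmodType R^c) n z : dT M n (dT M n.+1 z) = 0.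
Proof. by apply: tensor_map_comp0; right=> x; apply/exactS; exists x. Qed.

Lemma epsT_dT (M : lmodType R^c) z : epsT M (dT M 0 z) = 0.
Proof. by apply: tensor_map_comp0; right=> x; apply/exact0; exists x. Qed.

Definition is_cycle n (M : lmodType R^c) : tensor M (C n) -> Prop :=
  match n with 0 => fun _ => True | m.+1 => fun z => dT M m z = 0 end.

(** The iterated connecting homomorphism, as a relation between chains of
    [M (x) C] and elements of the model.  One step lifts [z] to a chain [l] of
    [cover M (x) C] and takes as [a] the boundary of [l], which lives in
    [syz M (x) C]; the last step applies the augmentation. *)
Fixpoint connecting (n : nat) (M : lmodType R^c) :
    tensor M (C n) -> tensor (syzygies n M) V -> Prop :=
  match n return tensor M (C n) -> tensor (syzygies n M) V -> Prop with
  | 0 => fun z v => epsT M z = v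
  | m.+1 => fun z v => exists l a,
      [/\ mapT (proj M) m.+1 l = z,
          dT (cover M) m l = mapT (inc M) m a
        & @connecting m (syz M) a v]
  end.

Lemma connecting_linear n (M : lmodType R^c) : linear_rel (@connecting n M).
Proof.
elim: n M => [|n IHn] M k z v z' v' /=; first by move=> <- <-; rewrite linearP.
move=> [l [a [<- la av]]] [l' [a' [<- la' av']]].
exists (k *: l + l'), (k *: a + a'); split; last exact: IHn.
  by rewrite linearP.
by rewrite !linearP /= la la'.
Qed.

Let projT_surj (M : lmodType R^c) n : surjective (mapT (proj M) n).
Proof. by apply: tensor_map_surj => // x; exists x. Qed.

Let incT_inj (M : lmodType R^c) n : injective (mapT (inc M) n).
Proof. exact: flat_left_inj. Qed.

Let incT_projT_exact (M : lmodType R^c) n :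
  exact_seq (mapT (inc M) n) (mapT (proj M) n).
Proof. exact: Cflat. Qed.

Let acyclic (M : lmodType R^c) n :
  exact_seq (dT (cover M) n.+1) (dT (cover M) n).
Proof. exact: cover_flat. Qed.

(** The boundary of the lift of a cycle dies in [M (x) C], so it comes from a
    cycle of [syz M (x) C].  When this cycle has degree zero, its
    class dies in [cover M (x) V], being the augmentation of a boundary. *)
Lemma connecting_total n (M : lmodType R^c) z : is_cycle z ->
  exists v, shifted_tor v /\ @connecting n M z v.
Proof.
elim: n M z => [|n IHn] M z /= dz; first by exists (epsT M z).
have [l lz] := @projT_surj M n.+1 z.
have [a al] : exists a, mapT (inc M) n a = dT (cover M) n l.
  by apply/incT_projT_exact; rewrite -tensor_mapC lz dz.
have aZ : is_cycle a.
  case: n {IHn z dz lz} l a al => [|n] l a al //.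
  by apply: incT_inj; rewrite -tensor_mapC al dT_dT linear0.
have [v [vT av]] := IHn _ _ aZ; exists v; split; last by exists l, a.
case: n {IHn z dz lz} l a al aZ v vT av => [|n] //= l a al _ v _ <-.
by rewrite -tensor_mapC al epsT_dT.
Qed.

(** Run the chase backwards: the image in [cover M (x) C] of a cycle [a] of
    [syz M (x) C] is a boundary, because [cover M] is flat.  If [a] has degree
    zero, where every chain is a cycle, it is the defining condition of the
    model that makes it one. *)
Lemma connecting_surj n (M : lmodType R^c) v : shifted_tor v ->
  exists z, is_cycle z /\ @connecting n M z v.
Proof.
elim: n M v => [|n IHn] M v vT /=.
  have [|z zv] := @tensor_map_surj _ _ M _ _ _ idfun eps _ eps_surj v.
    by move=> x; exists x.
  by exists z.
have [a [aZ av]] : exists a : tensor (syz M) (C n),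
    is_cycle a /\ connecting a v.
  by apply: (IHn (syz M) v); case: n {IHn} v vT.
have [l la] : exists l, dT (cover M) n l = mapT (inc M) n a.
  case: n {IHn} v vT a aZ av => [|n] v vT a aZ av.
    apply/(tensor_map_right_exact eps_surj exact0).
    by rewrite tensor_mapC av.
  apply/acyclic; rewrite tensor_mapC.
  by rewrite (aZ : dT _ n a = 0) linear0.
exists (mapT (proj M) n.+1 l); split; last by exists l, a.
rewrite tensor_mapC la; apply/incT_projT_exact.
by exists a.
Qed.

(** The connecting homomorphism loses nothing: [z] bounds exactly when [a]
    does, because [cover M (x) C] is acyclic in positive degrees; at the
    bottom, the augmentation kills exactly the boundaries. *)
Lemma connecting_boundary n (M : lmodType R^c) z v : @connecting n M z v ->
  (exists u, z = dT M n u) <-> v = 0.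
Proof.
elim: n M z v => [|n IHn] M z v /=.
  move=> <-; have := tensor_map_right_exact (M := M) eps_surj exact0 z.
  by move=> ->; split=> -[u]; exists u.
move=> [l [a [<- la av]]]; rewrite -(IHn _ _ _ av); split=> [[w lw]|[b ab]].
  have [w' w'w] := @projT_surj M n.+2 w.
  have [b bE] : exists b, mapT (inc M) n.+1 b =
      l - dT (cover M) n.+1 w'.
    by apply/incT_projT_exact; rewrite linearB /= -tensor_mapC w'w lw subrr.
  exists b; apply: incT_inj.
  by rewrite -tensor_mapC bE linearB /= dT_dT subr0 la.
have [w wE] : exists w, dT (cover M) n.+1 w = l - mapT (inc M) n.+1 b.
  by apply/acyclic; rewrite linearB /= tensor_mapC la ab subrr.
exists (mapT (proj M) n.+2 w); rewrite tensor_mapC wE linearB /=.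
have -> : mapT (proj M) n.+1 (mapT (inc M) n.+1 b) = 0.
  by apply/incT_projT_exact; exists b.
by rewrite subr0.
Qed.

End DimensionShift.

(** * Tor from flat resolutions *)

Section FlatResolutions.
Variables (K : fieldType) (R : algType K).

Lemma flat_presentations :
  exists (syz cover : lmodType R^c -> lmodType R^c)
    (inc : forall M, {linear syz M -> cover M})
    (proj : forall M, {linear cover M -> M}),
  [/\ forall M, injective (inc M), forall M, surjective (proj M),
      forall M, exact_seq (inc M) (proj M) & forall M, flat_right (cover M)].
Proof.
exists (fun M => syzygy M : lmodType R^c), (fun M => {malg R^c[M]}).
exists (fun M => (val : {linear syzygy M -> {malg R^c[M]}})).
exists (fun M => @free_cover R^c M); split=> M.
- exact: val_inj.
- exact: free_cover_surj.
- move=> l; split=> [l0|[x <-]]; last by apply/eqP; case: x.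
  by exists (Syzygy (introT eqP l0)).
exact: free_flat_right.
Qed.

Variables (M : lmodType R^c) (V : lmodType R).

(** Both homologies are isomorphic to the same model of [Tor_n(M, V)]; the two
    resolutions are never compared by a chain map. *)
Lemma flat_resolutions_homology
    (C D : nat -> lmodType R)
    (d : forall n, {linear C n.+1 -> C n}) (eps : {linear C 0 -> V})
    (e : forall n, {linear D n.+1 -> D n}) (eta : {linear D 0 -> V}) n :
  (forall i, flat_left (C i)) -> surjective eps ->
  exact_seq (d 0) eps -> (forall i, exact_seq (d i.+1) (d i)) ->
  (forall i, flat_left (D i)) -> surjective eta ->
  exact_seq (e 0) eta -> (forall i, exact_seq (e i.+1) (e i)) ->
  isomorphic
    (@homology K (fun i => tensor M (C i))
      (fun i => tensor_map (idfun : {linear M -> M}) (d i)) n)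
    (@homology K (fun i => tensor M (D i))
      (fun i => tensor_map (idfun : {linear M -> M}) (e i)) n).
Proof.
move=> Cflat eps_surj d0 dS Dflat eta_surj e0 eS.
have [syz [cover [inc [proj [inc_inj proj_surj inc_proj cover_flat]]]]] :=
  flat_presentations.
pose rho (x : tensor M (C n)) (y : tensor M (D n)) := exists v,
  connecting inc proj d eps x v /\ connecting inc proj e eta y v.
have total := connecting_total inc_inj proj_surj inc_proj.
have surj := connecting_surj inc_proj cover_flat.
have boundary := connecting_boundary inc_inj proj_surj inc_proj cover_flat.
have cycP (X : nat -> lmodType R) (dX : forall n, {linear X n.+1 -> X n}) m
    (x : tensor M (X m)) :
    is_cycle dX x <-> x \in @cycle_pred K (fun i => tensor M (X i))
      (fun i => tensor_map (idfun : {linear M -> M}) (dX i)) m.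
  by case: m x => [|m] x //; split=> [dx|/eqP //]; apply/eqP.
apply: (@homology_isomorphic_of_rel _ _ _ _ _ n rho).
- move=> k x y x' y' [v [xv yv]] [v' [xv' yv']].
  by exists (k *: v + v'); split; apply: connecting_linear.
- move=> x /cycP /(total _ _ _ _ Cflat d0 dS)[v [vT xv]].
  have [y [yZ yv]] := surj _ _ _ _ Dflat eta_surj e0 eS _ _ _ vT.
  by exists y; split; [apply/cycP|exists v].
- move=> y /cycP /(total _ _ _ _ Dflat e0 eS)[v [vT yv]].
  have [x [xZ xv]] := surj _ _ _ _ Cflat eps_surj d0 dS _ _ _ vT.
  by exists x; split; [apply/cycP|exists v].
move=> x y [v [xv yv]].
rewrite (boundary _ _ _ _ Cflat eps_surj d0 dS _ _ _ _ xv).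
by rewrite (boundary _ _ _ _ Dflat eta_surj e0 eS _ _ _ _ yv).
Qed.

End FlatResolutions.

(** * Tensoring with a bimodule *)

Section BimoduleMaps.
Variables (K : fieldType) (A S : algType K) (W : bimodType A S).

Definition tensor_bimod_map (M M' : lmodType A^c) (f : {linear M -> M'}) :
    tensor_bimod M W -> tensor_bimod M' W :=
  tensor_map f (idfun : {linear W -> W}).

Fact tensor_bimod_map_is_linear (M M' : lmodType A^c) (f : {linear M -> M'}) :
  linear (tensor_bimod_map f).
Proof.
move=> s x y; rewrite /tensor_bimod_map.
have -> : s *: x + y = tensor_bimod_scale s x + y by [].
rewrite linearD; congr (_ + _).
exact/esym/tensor_mapC.
Qed.

HB.instance Definition _ (M M' : lmodType A^c) (f : {linear M -> M'}) :=
  GRing.isLinear.Build S^c (tensor_bimod M W) (tensor_bimod M' W) *:%R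
    (tensor_bimod_map f) (tensor_bimod_map_is_linear f).

Definition bimod_tensor_map (U U' : lmodType S) (g : {linear U -> U'}) :
    bimod_tensor W U -> bimod_tensor W U' :=
  tensor_map (idfun : {linear right_of W -> right_of W}) g.

Fact bimod_tensor_map_is_linear (U U' : lmodType S) (g : {linear U -> U'}) :
  linear (bimod_tensor_map g).
Proof.
move=> a x y; rewrite /bimod_tensor_map.
have -> : a *: x + y = bimod_tensor_scale a x + y by [].
rewrite linearD; congr (_ + _).
exact: tensor_mapC.
Qed.

HB.instance Definition _ (U U' : lmodType S) (g : {linear U -> U'}) :=
  GRing.isLinear.Build A (bimod_tensor W U) (bimod_tensor W U') *:%R
    (bimod_tensor_map g) (bimod_tensor_map_is_linear g).

End BimoduleMaps.

Section Associativity.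
Variables (K : fieldType) (A S : algType K).
Variables (M : lmodType A^c) (W : bimodType A S) (U : lmodType S).

Local Notation MW_U := (tensor (tensor_bimod M W) U).
Local Notation M_WU := (tensor M (bimod_tensor W U)).

(** Triple tensors in the two bracketings. *)
Definition tensl (m : M) (w : W) (u : U) : MW_U :=
  tens (tens m w : tensor_bimod M W) u.

Definition tensr (m : M) (w : W) (u : U) : M_WU :=
  tens m (tens (w : right_of W) u : bimod_tensor W U).

(** The vector space structures coming from [A] and from [S] agree on [W]; this
    is where associativity uses that scalars act centrally on a bimodule. *)
Lemma tensl_central k m (w : W) u :
  tensl m ((k%:A : A) *: w) u = k *: tensl m w u.
Proof.
by rewrite /tensl -tensZl tensor_bimod_scale_tens -ract_central.
Qed.

Lemma tensr_central k m w u : tensr m w ((k%:A : S) *: u) = k *: tensr m w u.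
Proof.
rewrite /tensr -tensZr bimod_tensor_scale_tens -tens_bal.
by rewrite right_scaleE ract_central.
Qed.

Fact assoc_inner_subproof m :
  balanced_bilinear (fun (w : right_of W) u => tensl m w u).
Proof.
split=> [w w' u|w u u'|w s u|k w u]; rewrite /tensl.
- by rewrite (tensDr (N := W)); exact: tensDl.
- exact: tensDr.
- by rewrite -[RHS]tens_bal tensor_bimod_scale_tens.
exact: tensZr.
Qed.

Definition assoc_inner m : tensor (right_of W) U -> MW_U :=
  tensor_lift (assoc_inner_subproof m).

Lemma assoc_inner_tens m w u : assoc_inner m (tens w u) = tensl m w u.
Proof. exact: tensor_lift_tens. Qed.

Fact assoc_inner0 m : assoc_inner m 0 = 0.
Proof. exact: linear0. Qed.

Fact assoc_innerD m x y :
  assoc_inner m (x + y) = assoc_inner m x + assoc_inner m y.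
Proof. exact: linearD. Qed.

Fact assoc_subproof :
  balanced_bilinear (fun m (t : bimod_tensor W U) => assoc_inner m t).
Proof.
split=> [m m' t|m t t'|m a t|k m t].
- move: t; apply: tensor_ind => [|x y ex ey|w u].
  + by rewrite !assoc_inner0 addr0.
  + by rewrite !assoc_innerD ex ey addrACA.
  by rewrite !assoc_inner_tens /tensl tensDl; exact: tensDl.
- exact: assoc_innerD.
- move: t; apply: tensor_ind => [|x y ex ey|w u].
  + by rewrite scaler0 !assoc_inner0.
  + by rewrite scalerDr !assoc_innerD ex ey.
  rewrite bimod_tensor_scale_tens !assoc_inner_tens /tensl.
  by rewrite (tens_bal (N := W)).
move: t; apply: tensor_ind => [|x y ex ey|w u].
- by rewrite scaler0 !assoc_inner0 scaler0.
- by rewrite scalerDr !assoc_innerD ex ey scalerDr.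
by rewrite bimod_tensor_scale_tens !assoc_inner_tens tensl_central.
Qed.

Definition assoc : M_WU -> MW_U := tensor_lift assoc_subproof.

HB.instance Definition _ := GRing.Linear.on assoc.

Lemma assoc_tensr m w u : assoc (tensr m w u) = tensl m w u.
Proof. by rewrite /assoc tensor_lift_tens assoc_inner_tens. Qed.

Fact assoc_inv_inner_subproof u :
  balanced_bilinear (fun m (w : W) => tensr m w u).
Proof.
split=> [m m' w|m w w'|m a w|k m w]; rewrite /tensr.
- exact: tensDl.
- by rewrite (tensDl (M := right_of W)); exact: tensDr.
- by rewrite tens_bal bimod_tensor_scale_tens.
by rewrite -bimod_tensor_scale_tens tensZr.
Qed.

Definition assoc_inv_inner u : tensor M W -> M_WU :=
  tensor_lift (assoc_inv_inner_subproof u).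

Lemma assoc_inv_inner_tens u m w : assoc_inv_inner u (tens m w) = tensr m w u.
Proof. exact: tensor_lift_tens. Qed.

Fact assoc_inv_inner0 u : assoc_inv_inner u 0 = 0.
Proof. exact: linear0. Qed.

Fact assoc_inv_innerD u x y :
  assoc_inv_inner u (x + y) = assoc_inv_inner u x + assoc_inv_inner u y.
Proof. exact: linearD. Qed.

Fact assoc_inv_subproof :
  balanced_bilinear (fun (t : tensor_bimod M W) u => assoc_inv_inner u t).
Proof.
split=> [t t' u|t u u'|t s u|k t u].
- exact: assoc_inv_innerD.
- move: t; apply: tensor_ind => [|x y ex ey|m w].
  + by rewrite !assoc_inv_inner0 addr0.
  + by rewrite !assoc_inv_innerD ex ey addrACA.
  by rewrite !assoc_inv_inner_tens /tensr (tensDr (N := U)); exact: tensDr.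
- move: t; apply: tensor_ind => [|x y ex ey|m w].
  + by rewrite scaler0 !assoc_inv_inner0.
  + by rewrite scalerDr !assoc_inv_innerD ex ey.
  rewrite tensor_bimod_scale_tens !assoc_inv_inner_tens /tensr.
  by rewrite -(tens_bal (M := right_of W)).
move: t; apply: tensor_ind => [|x y ex ey|m w].
- by rewrite !assoc_inv_inner0 scaler0.
- by rewrite !assoc_inv_innerD ex ey scalerDr.
by rewrite !assoc_inv_inner_tens tensr_central.
Qed.

Definition assoc_inv : MW_U -> M_WU := tensor_lift assoc_inv_subproof.

HB.instance Definition _ := GRing.Linear.on assoc_inv.

Lemma assoc_inv_tensl m w u : assoc_inv (tensl m w u) = tensr m w u.
Proof. by rewrite /assoc_inv tensor_lift_tens assoc_inv_inner_tens. Qed.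

Lemma tensr_ind (P : M_WU -> Prop) :
  P 0 -> (forall x y, P x -> P y -> P (x + y)) ->
  (forall m w u, P (tensr m w u)) -> forall t, P t.
Proof.
move=> P0 PD Pt; apply: tensor_ind => // m.
apply: tensor_ind => [|x y Px Py|w u]; last exact: Pt.
  by rewrite tens0r.
by rewrite tensDr; apply: PD.
Qed.

Lemma tensl_ind (P : MW_U -> Prop) :
  P 0 -> (forall x y, P x -> P y -> P (x + y)) ->
  (forall m w u, P (tensl m w u)) -> forall t, P t.
Proof.
move=> P0 PD Pt; apply: tensor_ind => // t u; move: t.
apply: tensor_ind => [|x y Px Py|m w]; last exact: Pt.
  by rewrite tens0l.
by rewrite tensDl; apply: PD.
Qed.

Lemma assocK : cancel assoc assoc_inv.
Proof.
apply: tensr_ind => [|x y ex ey|m w u]; first by rewrite !linear0.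
  by rewrite !linearD /= ex ey.
by rewrite assoc_tensr assoc_inv_tensl.
Qed.

Lemma assoc_invK : cancel assoc_inv assoc.
Proof.
apply: tensl_ind => [|x y ex ey|m w u]; first by rewrite !linear0.
  by rewrite !linearD /= ex ey.
by rewrite assoc_inv_tensl assoc_tensr.
Qed.

End Associativity.

Arguments assoc {K A S M W U}.
Arguments assoc_inv {K A S M W U}.

Section Naturality.
Variables (K : fieldType) (A S : algType K) (W : bimodType A S).

Lemma assoc_inv_natural_left (M M' : lmodType A^c) (U : lmodType S)
    (f : {linear M -> M'}) (t : tensor (tensor_bimod M W) U) :
  assoc_inv
    (tensor_map (@tensor_bimod_map K A S W _ _ f) (idfun : {linear U -> U}) t) =
  tensor_map f (idfun : {linear bimod_tensor W U -> bimod_tensor W U})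
    (assoc_inv t).
Proof.
move: t; apply: tensl_ind => [|x y ex ey|m w u]; first by rewrite !linear0.
  by rewrite !linearD /= ex ey.
rewrite assoc_inv_tensl tensor_map_tens /= /tensor_bimod_map tensor_map_tens /=.
by rewrite tensor_map_tens; exact: assoc_inv_tensl.
Qed.

Lemma assoc_natural_right (M : lmodType A^c) (U U' : lmodType S)
    (g : {linear U -> U'}) (t : tensor M (bimod_tensor W U)) :
  assoc
    (tensor_map (idfun : {linear M -> M}) (@bimod_tensor_map K A S W _ _ g) t) =
  tensor_map (idfun : {linear tensor_bimod M W -> tensor_bimod M W}) g
    (assoc t).
Proof.
move: t; apply: tensr_ind => [|x y ex ey|m w u]; first by rewrite !linear0.
  by rewrite !linearD /= ex ey.
rewrite assoc_tensr tensor_map_tens /= /bimod_tensor_map tensor_map_tens /=.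
by rewrite tensor_map_tens; exact: assoc_tensr.
Qed.

End Naturality.

(** * Change of rings and the Shapiro isomorphism *)

Section ChangeOfRings.
Variables (K : fieldType) (A S : algType K) (W : bimodType A S).

(** By associativity, tensoring with [W (x) U] is the composite of tensoring
    with [W] and tensoring with [U], two exact functors. *)
Lemma bimod_tensor_flat_left (U : lmodType S) :
  flat_left W -> flat_left U -> flat_left (bimod_tensor W U).
Proof.
move=> Wflat Uflat M1 M2 M3 f g fg t.
have WUexact : exact_seq
    (tensor_map (@tensor_bimod_map K A S W _ _ f) (idfun : {linear U -> U}))
    (tensor_map (@tensor_bimod_map K A S W _ _ g) (idfun : {linear U -> U})).
  exact/Uflat/Wflat.
split=> [gt0|[s <-]]; last first.
  by apply: tensor_map_comp0; left=> m; apply/fg; exists m.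
have [s st] : exists s, tensor_map (@tensor_bimod_map K A S W _ _ f)
    (idfun : {linear U -> U}) s = assoc t.
  apply/WUexact; apply: (can_inj (@assoc_invK K A S M3 W U)).
  apply: (etrans (assoc_inv_natural_left g (assoc t))).
  by rewrite (assocK t) gt0 linear0.
exists (assoc_inv s); rewrite -(assocK t) -st.
exact/esym/assoc_inv_natural_left.
Qed.

Lemma tensor_map_bij (M M' : lmodType S^c) (U : lmodType S)
    (f : {linear M -> M'}) :
  bijective f -> bijective (tensor_map f (idfun : {linear U -> U})).
Proof.
move=> [g fK gK].
pose gL := HB.pack_for {linear M' -> M} g
  (GRing.isLinear.Build S^c M' M *:%R g (can2_linear fK gK)).
exists (tensor_map gL idfun); apply: tensor_ind => [|x y ex ey|m n].
- by rewrite !linear0.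
- by rewrite !linearD /= ex ey.
- by rewrite !tensor_map_tens /= fK.
- by rewrite !linear0.
- by rewrite !linearD /= ex ey.
by rewrite !tensor_map_tens /= gK.
Qed.

(** Shapiro's lemma for arbitrary algebras.  [W (x) Q] is exact because [W] is
    flat on the right and consists of flat modules because [W] is flat on the
    left; it therefore computes [Tor(M, W (x) U)], and associativity turns
    [M (x) (W (x) Q)] into [(M (x) W) (x) Q], that is [N (x) Q]. *)
Lemma Tor_bimod_tensor (M : lmodType A^c) (N : lmodType S^c) (U : lmodType S)
    (P : projective_resolution (bimod_tensor W U))
    (Q : projective_resolution U) (n : nat) :
  flat_right (right_of W) -> flat_left W ->
  @isomorphic S^c (tensor_bimod M W) N ->
  isomorphic (Tor n M P) (Tor n N Q).
Proof.
move=> W_flat_right W_flat_left [phi phi_bij].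
pose WQ i : lmodType A := bimod_tensor W (Q i).
pose dWQ i : {linear WQ i.+1 -> WQ i} :=
  @bimod_tensor_map K A S W _ _ (res_d Q i).
pose augWQ : {linear WQ 0 -> bimod_tensor W U} :=
  @bimod_tensor_map K A S W _ _ (res_aug Q).
apply: (@isomorphic_trans _ _ (@homology K (fun i => tensor M (WQ i))
  (fun i => tensor_map (idfun : {linear M -> M}) (dWQ i)) n)).
  apply: (@flat_resolutions_homology K A M (bimod_tensor W U) P WQ
    (res_d P) (res_aug P) dWQ augWQ).
  - by move=> i; apply/projective_flat_left/res_projective.
  - exact: res_aug_surj.
  - exact: res_exact0.
  - exact: res_exactS.
  - move=> i; apply: bimod_tensor_flat_left => //.
    exact/projective_flat_left/res_projective.
  - apply: tensor_map_surj; first by move=> w; exists w.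
    exact: res_aug_surj.
  - exact: W_flat_right (@res_exact0 _ _ Q).
  - by move=> i; exact: W_flat_right (@res_exactS _ _ Q i).
apply: (@homology_isomorphic_of_bij _ _ _ _ _ n
  (fun i => tensor_map phi (idfun : {linear Q i -> Q i}) \o assoc)).
- move=> i; apply: bij_comp; first exact: tensor_map_bij.
  by exists assoc_inv; [exact: assocK|exact: assoc_invK].
move=> i x /=; rewrite tensor_mapC; congr tensor_map.
exact: assoc_natural_right.
Qed.

End ChangeOfRings.

Theorem theorem3p1 (K : fieldType) (G H : groupType)
    (W : bimodType (par_algebra K G) (group_algebra K H))
    (W_flat_KH : flat_right (right_of W))
    (W_flat_KparG : flat_left W)
    (BW_trivial : @isomorphic (group_algebra K H)^c
       (tensor_bimod (par_B K G) W) (trivial_module K H))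
    (U : lmodType (group_algebra K H))
    (P : projective_resolution (bimod_tensor W U))
    (Q : projective_resolution U) (i : nat) :
  @isomorphic K (par_homology i P) (group_homology i Q).
Proof. exact: Tor_bimod_tensor. Qed.
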